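(* Let $\mathcal{K}=\{x\in\mathbb{R}^n: g_1(x)\ge 0,\ldots,g_q(x)\ge 0\}$ be a compact basic semialgebraic set that satisfies the Archimedean condition, and let $B^*$ and $B^*_{d,\nu}$ be the optimal values of the polynomial matrix inequality problem and of its sparsity-exploiting SOS reformulation defined in the context. If there exists $\lambda_0 \in \mathbb{R}^\ell$ such that $P(x, \lambda_0)$ is strictly positive definite for all $x\in\mathcal{K}$, then $B_{d,0}^* \to B^*$ from above as $d \to \infty$.
   Context: Polynomials have real coefficients, $x=(x_1,\ldots,x_n)$, $\|x\|^2=x_1^2+\cdots+x_n^2$. Let $b:\mathbb{R}^\ell\to\mathbb{R}$ be convex, let $P_0,\ldots,P_\ell$ be $m\times m$ symmetric polynomial matrices in $x$, let $P(x,\lambda):=P_0(x)-\sum_{i=1}^\ell P_i(x)\lambda_i$ for $\lambda\in\mathbb{R}^\ell$, and let $g_1,\ldots,g_q$ be the polynomials defining $\mathcal{K}$. The polynomial matrix inequality problem is $$B^* := \inf_{\lambda\in\mathbb{R}^\ell} b(\lambda)\quad\text{s.t.}\quad P(x,\lambda)\succeq 0\ \ \forall x\in\mathcal{K}.$$ The sparsity graph of $P$ is the undirected graph with vertices $\{1,\ldots,m\}$ in which, for $i\neq j$, $(i,j)$ is not an edge if and only if $P_{ij}(x,\lambda)$ vanishes identically (in $x$ and $\lambda$). It is assumed to be chordal (every cycle of length at least $4$ has an edge joining two nonconsecutive vertices), with maximal cliques $\mathcal{C}_1,\ldots,\mathcal{C}_t$ (a clique is a set of pairwise adjacent vertices;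 it is maximal if not contained in another clique). For a clique $\mathcal{C}$ with elements $\mathcal{C}(1)<\cdots<\mathcal{C}(|\mathcal{C}|)$, $E_{\mathcal{C}}\in\mathbb{R}^{|\mathcal{C}|\times m}$ has $(E_{\mathcal{C}})_{ij}=1$ if $\mathcal{C}(i)=j$ and $0$ otherwise. A polynomial matrix $S(x)$ is SOS if $S=H^{\mathsf T}H$ for some (possibly rectangular) polynomial matrix $H$; an SOS polynomial is a finite sum of squares of polynomials. $\Sigma^{p}_{2\omega}$ denotes the cone of $p\times p$ SOS matrices in $n$ variables of degree at most $2\omega$. For integers $\nu\ge 0$ and $d$ with $2d\ge\max\{\deg(P),\deg(g_1),\ldots,\deg(g_q)\}+2\nu$ (degrees in $x$), the SOS reformulation is $$B_{d,\nu}^* := \inf_{\lambda,\,S_{j,k}} b(\lambda)\quad\text{s.t.}\quad \sigma(x)^\nu P(x,\lambda)=\sum_{k=1}^t E_{\mathcal{C}_k}^{\mathsf T}\Big(S_{0,k}(x)+\sum_{j=1}^q g_j(x)S_{j,k}(x)\Big)E_{\mathcal{C}_k},\quad S_{j,k}\in\Sigma^{|\mathcal{C}_k|}_{2d_j}\ \ (j=0,\ldots,q,\ k=1,\ldots,t),$$ where $d_0:=d$, $d_j:=d-\lceil\tfrac12\deg(g_j)\rceil$ for $j=1,\ldots,q$, and $\sigma(x)=\|x\|^2$ or $1+\|x\|^2$ depending on whether $P$ is homogeneous in $x$ or not; for $\nu=0$ the factor $\sigma(x)^\nu$ equals $1$. The infimum over an empty set is $+\infty$. The set $\mathcal{K}$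 satisfies the Archimedean condition if there exist SOS polynomials $\sigma_0,\ldots,\sigma_q$ and $r\in\mathbb{R}$ such that $\sigma_0(x)+g_1(x)\sigma_1(x)+\cdots+g_q(x)\sigma_q(x)=r^2-\|x\|^2$. *)

(* Defs.v *)
From mathcomp Require Import all_boot all_order all_algebra.
From mathcomp Require Import all_classical all_reals all_analysis.
(* The notations of mpoly are incompatible with those of mathcomp-analysis, so
   {mpoly R[n]}, p.@[v], c%:MP and 'X_i are written mpoly n R, meval v p,
   mpolyC n c and mpolyX R (mnm1 i). *)
From mathcomp Require mpoly.
Import -(notations) mpoly.

Set Implicit Arguments.
Unset Strict Implicit.
Unset Printing Implicit Defensive.

Import Order.TTheory GRing.Theory Num.Theory.
Import numFieldNormedType.Exports.

Local Open Scope classical_set_scope.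
Local Open Scope ring_scope.

Section Matrices.
Context {R : realType}.

Definition psdmx m (A : 'M[R]_m) : Prop :=
  A^T = A /\ forall v : 'cV[R]_m, 0 <= (v^T *m A *m v) ord0 ord0.

Definition pdmx m (A : 'M[R]_m) : Prop :=
  A^T = A /\ forall v : 'cV[R]_m, v != 0 -> 0 < (v^T *m A *m v) ord0 ord0.

End Matrices.

Section PolynomialMatrices.
Context {R : realType} {n : nat}.

Definition evalp (x : 'rV[R]_n) (p : mpoly n R) : R := meval (x ord0) p.

Definition evalmx m (x : 'rV[R]_n) (A : 'M[mpoly n R]_m) : 'M[R]_m :=
  map_mx (evalp x) A.

(* [msize] is the degree plus one; the zero polynomial gets degree 0. *)
Definition degp (p : mpoly n R) : nat := (msize p).-1.

Definition degmx m (A : 'M[mpoly n R]_m) : nat :=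
  (\max_(i < m) \max_(j < m) degp (A i j))%N.

Definition normsq : mpoly n R := \sum_(i < n) mpolyX R (mnm1 i) ^+ 2.

Definition sosp (p : mpoly n R) : Prop :=
  exists (s : nat) (h : 'I_s -> mpoly n R), p = \sum_(i < s) h i ^+ 2.

Definition sosmx m (A : 'M[mpoly n R]_m) : Prop :=
  exists (s : nat) (H : 'M[mpoly n R]_(s, m)), A = H^T *m H.

(* The cone usually written Sigma^m_{2 w}. *)
Definition sos_cone m (w : nat) : set 'M[mpoly n R]_m :=
  [set A | sosmx A /\ (degmx A <= 2 * w)%N].

Definition semialg q (g : 'I_q -> mpoly n R) : set 'rV[R]_n :=
  [set x | forall j, 0 <= evalp x (g j)].

Definition archimedean_condition q (g : 'I_q -> mpoly n R) : Prop :=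
  exists (s0 : mpoly n R) (s : 'I_q -> mpoly n R) (r : R),
    [/\ sosp s0, forall j, sosp (s j) &
        s0 + \sum_(j < q) g j * s j = mpolyC n (r ^+ 2) - normsq].

End PolynomialMatrices.

Section Graphs.
Context {V : finType}.
Implicit Type e : rel V.

Definition clique e (A : {set V}) : bool :=
  [forall i in A, forall j in A, (i != j) ==> e i j].

(* [c] lists the vertices of a simple cycle, and [next c] is the cyclic
   successor along it. *)
Definition chordal e : Prop :=
  forall c : seq V, ucycle e c -> (4 <= size c)%N ->
    exists x y, [/\ x \in c, y \in c, y != next c x, x != next c y & e x y].

Definition lists_maximal_cliques e t (C : 'I_t -> {set V}) : Prop :=
  injective C /\ forall A, maxset (clique e) A <-> exists k, C k = A.

End Graphs.

(* [enum_val] lists the elements of [C : {set 'I_m}] in increasing order. *)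
Definition cliquemx {A : pzSemiRingType} m (C : {set 'I_m}) : 'M[A]_(#|C|, m) :=
  \matrix_(i, j) (enum_val i == j)%:R.

Section PolynomialMatrixInequality.
Context {R : realType} {n m l : nat}.
Variables (P0 : 'M[mpoly n R]_m) (P : 'I_l -> 'M[mpoly n R]_m).

Definition pmx (lam : 'rV[R]_l) : 'M[mpoly n R]_m :=
  P0 - \sum_(i < l) mpolyC n (lam ord0 i) *: P i.

(* Degree in x of P(x, lambda), lambda being indeterminate. *)
Definition deg_pmx : nat := maxn (degmx P0) (\max_(i < l) degmx (P i)).

Definition homogeneous_pmx : Prop :=
  exists e : nat, forall lam i j, pmx lam i j \is ishomog1 e mdeg.

Definition sparsity_graph : rel 'I_m :=
  fun i j => (i != j) && ~~ `[< forall lam, pmx lam i j = 0 >].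

Definition pmi_feasible (K : set 'rV[R]_n) : set 'rV[R]_l :=
  [set lam | forall x, K x -> psdmx (evalmx x (pmx lam))].

Definition pmi_value (b : 'rV[R]_l -> R) (K : set 'rV[R]_n) : \bar R :=
  ereal_inf [set (b lam)%:E | lam in pmi_feasible K].

Definition multiplier : mpoly n R :=
  if `[< homogeneous_pmx >] then normsq else 1 + normsq.

Variables (q : nat) (g : 'I_q -> mpoly n R).

Definition admissible (d nu : nat) : Prop :=
  (maxn deg_pmx (\max_(j < q) degp (g j)) + 2 * nu <= 2 * d)%N.

Variables (t : nat) (C : 'I_t -> {set 'I_m}).

(* The subtraction [d - uphalf _] does not truncate when [admissible d nu]. *)
Definition sos_feasible (d nu : nat) : set 'rV[R]_l :=
  [set lam | exists (S0 : forall k, 'M[mpoly n R]_#|C k|)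
                    (S : 'I_q -> forall k, 'M[mpoly n R]_#|C k|),
    [/\ multiplier ^+ nu *: pmx lam =
          \sum_(k < t) (cliquemx (C k))^T *m
            (S0 k + \sum_(j < q) g j *: S j k) *m cliquemx (C k),
        forall k, sos_cone d (S0 k) &
        forall j k, sos_cone (d - uphalf (degp (g j)))%N (S j k)]].

Definition sos_value (b : 'rV[R]_l -> R) (d nu : nat) : \bar R :=
  ereal_inf [set (b lam)%:E | lam in sos_feasible d nu].

End PolynomialMatrixInequality.

(* Main.v *)
(* Dirac: a chordal graph has a simplicial vertex.  Eliminating such a vertex
   from a positive semidefinite matrix by a Schur complement creates no fill-in,
   so a constant psd matrix with chordal pattern is a sum of terms [w w^T] with
   each [w] supported on a clique.

   Let F be a sparse symmetric polynomial matrix, positive definite on K.  The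
   Archimedean condition puts [r^2 - |x|^2] in the quadratic module for some
   [r > 0].  Subtracting [sum_j g_j s_j I], with [s_j] a large even power of
   [1 - g_j / M] up to a constant, makes F positive definite on the whole box
   [-r, r]^n by compactness.  Expand the result in the tensor Bernstein basis of large degree N on the box: the
   coefficients are constant matrices with the same pattern, uniformly close to
   the values on the grid, hence positive semidefinite and decomposable along
   the cliques, while each basis polynomial is a product of [r + x_i] and
   [r - x_i], which lie in the preorder generated by [r^2 - |x|^2].  So F admits
   the sparse SOS certificate of some degree.

   For convergence, apply this to [P(x, s lam0 + (1 - s) lam)] with [lam]
   feasible and [s > 0] small, and use the convexity of b and the monotonicity
   of the relaxation in d. *)
Require Import Defs.
From mathcomp Require Import all_boot all_order all_algebra.
From mathcomp Require Import all_classical all_reals all_analysis.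
From mathcomp Require Import zify ring lra.
From mathcomp Require mpoly.
Import -(notations) mpoly.
Import Order.TTheory GRing.Theory Num.Theory.
Import numFieldNormedType.Exports.

Set Implicit Arguments.
Unset Strict Implicit.
Unset Printing Implicit Defensive.

(** * Simplicial vertices of chordal graphs *)

Section ChordalGraphs.
Context {V : finType} (e : rel V).
Hypothesis (esym : ssrbool.symmetric e) (eirr : irreflexive e) (che : chordal e).

(** Relative to the subgraph induced on [W]: eliminations shrink [W] while the relation [e] stays
    fixed. *)
Definition simplicial (W : {set V}) (v : V) : bool :=
  [forall x in W, forall y in W, [&& e v x, e v y & x != y] ==> e x y].

Lemma simplicialP (W : {set V}) v :
  reflect {in W &, forall x y, e v x -> e v y -> x != y -> e x y}
          (simplicial W v).
Proof.
apply: (iffP forall_inP) => [h x y xW yW vx vy xy|h x xW].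
  by have /forall_inP/(_ y yW)/implyP := h x xW; apply; rewrite vx vy xy.
by apply/forall_inP => y yW; apply/implyP => /and3P[]; exact: h.
Qed.

(* A shortest path through [N] from [s] to [s'] would close up through [u]
   into a chordless cycle of length at least 4. *)
Lemma chordal_separator_adjacent (N : {set V}) u s s' (p : seq V) :
  u \notin N -> {in N, forall v, ~~ e u v} -> e u s -> e u s' -> s != s' ->
  path e s p -> last s p = s' ->
  {subset p <= [predU1 s & [predU1 s' & N]]} -> e s s'.
Proof.
move=> uN Nu us us' ss' es ls pN; apply: contraT => ness'.
(* Strong induction on the length replaces the choice of a shortest path: any shorter path already
   gives the contradiction. *)
have [k] := ubnP (size p); elim: k p es ls pN => // k IHk p es ls pN.
rewrite ltnS => pk.
move: ls; case/shortenP: es => p' es up pp' ls.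
have sizep' : (size p' <= k)%N.
  apply: leq_trans pk; apply: uniq_leq_size => //; by case/andP: up.
have p'N : {subset s :: p' <= [predU1 s & [predU1 s' & N]]}.
  by move=> x; rewrite inE => /predU1P[->|/pp' /pN //]; rewrite !inE eqxx.
(* A chord that skips part of the path yields a shorter path. If [y] directly follows [x], it is the
   cyclic successor of [x], which is excluded. *)
have shortcut q1 q2 x y : s :: p' = q1 ++ x :: q2 -> y \in q2 ->
    y != next [:: u, s & p'] x -> ~~ e x y.
  move=> defq /splitPr yq2.
  case: q2 / yq2 defq => -[|z q2] q3 defq yx.
    suff : y == next [:: u, s & p'] x by rewrite (negPf yx).
    rewrite next_nth inE defq mem_cat mem_head !orbT -cat_cons index_cat.
    case: ifP => [xq1|_].
      exfalso; move: xq1; rewrite inE => /predU1P[xu|xq1].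
        have /p'N : x \in s :: p' by rewrite defq mem_cat mem_head orbT.
        rewrite xu !inE (negPf uN) orbF => /orP[]/eqP us_.
          by move: us; rewrite us_ eirr.
        by move: us'; rewrite us_ eirr.
      by move: up; rewrite defq cat_uniq /= xq1 /= andbF.
    by rewrite nth_cat /= eqxx addn0 ltnNge leqnSn /= subSn //= subnn.
  apply/negP => exy.
  have [p2 [defp2 lp2 ep2 sp2]] : exists p2, [/\ s :: p2 = q1 ++ x :: y :: q3,
      last s p2 = s', path e s p2 & (size p2 < size p')%N].
    case: q1 defq => [|s1 q1] [sx defp']; rewrite -sx.
      exists (y :: q3); split=> //; last by rewrite defp' /= size_cat /= addnS; lia.
        by rewrite -ls defp' /= last_cat.
      by move: es; rewrite defp' /= cat_path /= => /and4P[_ _ _ ->]; rewrite sx exy.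
    exists (q1 ++ x :: y :: q3); split=> //.
    - by rewrite -ls defp' !last_cat /= last_cat.
    - move: es; rewrite defp' !cat_path /= cat_path /=.
      by move=> /and5P[-> -> _ _ /andP[_ ->]]; rewrite exy.
    - by rewrite defp' !size_cat /= size_cat /=; lia.
  suff : false by [].
  apply: (IHk p2) => //; last exact: leq_trans sp2 sizep'.
  move=> v vp2; apply: p'N; rewrite defq.
  have : v \in s :: p2 by rewrite inE vp2 orbT.
  by rewrite defp2 !(mem_cat, inE) => /or4P[] ->; rewrite ?orbT.
have uN' : u \notin s :: p'.
  apply: contraTN isT => /p'N; rewrite !inE (negPf uN) orbF => /orP[]/eqP us_.
    by move: us; rewrite us_ eirr.
  by move: us'; rewrite us_ eirr.
have cyc : ucycle e [:: u, s & p'].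
  rewrite /ucycle cons_uniq uN' up andbT /= us rcons_path es ls esym us' //.
suff : False by [].
have [] := che cyc.
  (* Fewer than four vertices would force [s = s'] or the edge from [s] to [s'], both excluded. *)
  case: p' es ls {sizep' pp' p'N shortcut uN' cyc up} => [|a [|c p']] //=.
    by move=> _ /eqP; rewrite (negPf ss').
  by rewrite andbT => + sa; rewrite sa (negPf ness').
have nu : next [:: u, s & p'] u = s by rewrite /= eqxx.
have ns' : next [:: u, s & p'] s' = u.
  have lsu : s' \in s :: p' by rewrite -ls mem_last.
  rewrite next_nth inE lsu orbT.
  have -> : index s' [:: u, s & p'] = (size p').+1.
    rewrite -[LHS]/(if u == s' then 0%N else (index s' (s :: p')).+1).
    case: eqP => [us_|_]; first by move: us'; rewrite us_ eirr.
    by rewrite -{1}ls index_last.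
  by rewrite nth_default.
(* No chord starts at [u]: its cyclic neighbours are [s] and [s'], and all other path vertices lie
   in [N]. *)
have uchord y : y \in s :: p' -> y != next [:: u, s & p'] u ->
    u != next [:: u, s & p'] y -> ~~ e u y.
  move=> /p'N; rewrite !inE => /or3P[/eqP ->|/eqP ->|yN _ _]; last exact: Nu.
    by rewrite nu eqxx.
  by rewrite ns' eqxx.
move=> x [y [+ + yx xy exy]]; rewrite inE => /predU1P[xu|xp].
  rewrite inE => /predU1P[yu|yp]; first by move: exy; rewrite xu yu eirr.
  by move: yx xy exy; rewrite xu => yx xy; apply/negP; exact: uchord.
rewrite inE => /predU1P[yu|yp].
  by move: yx xy exy; rewrite yu esym => yx xy; apply/negP; exact: uchord.
have [q1 [q2 defq]] : exists q1 q2, s :: p' = q1 ++ x :: q2.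
  by case/splitPr: xp => q1 q2; exists q1, q2.
(* Both ends of the chord lie on the path; [shortcut] applies from whichever comes first. *)
move: yp; rewrite defq mem_cat inE => /or3P[yq1|/eqP yx'|yq2].
- have [q3 [q4 defq1]] : exists q3 q4, q1 = q3 ++ y :: q4.
    by case/splitPr: yq1 => q3 q4; exists q3, q4.
  move: exy; rewrite esym; apply/negP.
  apply: (shortcut q3 (q4 ++ x :: q2)) => //.
    by rewrite defq defq1 -catA.
  by rewrite mem_cat mem_head orbT.
- by move: exy; rewrite yx' eirr.
- by move: exy; apply/negP; exact: (shortcut q1 q2).
Qed.

(** Dirac's theorem, strengthened for induction by placing the simplicial vertex away from [u]. Let
    [D] be the component of [w] among the non-neighbours of [u] in [W], and [S] its outer boundary
    in [W]. Then [S] consists of neighbours of [u] and is a clique, and [D :|: S] omits [u], so the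
    induction applies to it. A vertex of [D] has all its [W]-neighbours in [D :|: S], so being
    simplicial there lifts to [W]. *)
Lemma chordal_simplicial_nonadjacent (W : {set V}) u w :
  u \in W -> w \in W -> w != u -> ~~ e u w ->
  exists v, [/\ v \in W, v != u, ~~ e u v & simplicial W v].
Proof.
have [k] := ubnP #|W|; elim: k W u w => // k IHk W u w.
rewrite ltnS => Wk uW wW wu nuw.
pose N := [set v in W | (v != u) && ~~ e u v].
have wN : w \in N by rewrite inE wW wu.
pose r := [rel x y | [&& e x y, x \in N & y \in N]].
have rsym : connect_sym r.
  by apply: sym_connect_sym => x y; rewrite /= esym; congr (_ && _); rewrite andbC.
pose D := [set y | connect r w y].
have wD : w \in D by rewrite inE connect0.
have DN y : y \in D -> y \in N.
  rewrite inE => /connectP[p + ->]; elim/last_ind: p => //= p z _.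
  by rewrite rcons_path last_rcons => /andP[_ /and3P[]].
pose S := [set s in W | (s \notin D) && [exists d in D, e s d]].
have Su s : s \in S -> e u s.
  rewrite inE => /and3P[sW sD /exists_inP[d dD sd]].
  have dN := DN d dD.
  apply: contraNT sD => nus.
  have su : s != u.
    by apply: contraTneq sd => ->; move: dN; rewrite inE => /and3P[].
  rewrite inE; move: dD; rewrite inE => /connect_trans; apply.
  by apply: connect1; rewrite /= esym sd dN inE sW su nus.
have uNN : u \notin N by rewrite inE eqxx andbF.
have Nu : {in N, forall v, ~~ e u v} by move=> v; rewrite inE => /and3P[].
(* Two boundary vertices are joined by a path whose interior lies in [D], hence in [N]. *)
have Scl s s' : s \in S -> s' \in S -> s != s' -> e s s'.
  move=> sS s'S ss'.
  have Sd z : z \in S -> exists2 d, d \in D & e z d.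
    by rewrite inE => /and3P[_ _ /exists_inP].
  have [[d dD sd] [d' d'D s'd']] := (Sd s sS, Sd s' s'S).
  have : connect r d d'.
    by move: dD d'D; rewrite !inE rsym; exact: connect_trans.
  move=> /connectP[p dp d'p].
  apply: (@chordal_separator_adjacent N u s s' (d :: rcons p s')) => //; rewrite ?Su //.
  - rewrite /= sd rcons_path -d'p esym s'd' andbT.
    by apply: sub_path dp => x y /= /and3P[].
  - by rewrite /= last_rcons.
  - have pN : {subset p <= N}.
      elim: p d {d'p sd dD} dp => //= a p IHp d /andP[/and3P[_ _ aN] ap] x.
      by rewrite inE => /predU1P[->//|]; exact: (IHp a ap x).
    move=> x; rewrite inE mem_rcons inE => xp.
    suff : [|| x == s, x == s' | x \in N] by [].
    case/or3P: xp => [/eqP ->|/eqP ->|/pN ->]; rewrite ?eqxx ?orbT //.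
    by rewrite DN // !orbT.
pose W' := D :|: S.
have uW' : u \notin W'.
  rewrite inE negb_or; apply/andP; split; first by apply: contra uNN; exact: DN.
  by apply: contraTN isT => /Su; rewrite eirr.
have W'W : W' \subset W.
  by apply/fintype.subsetP => x; rewrite inE => /orP[/DN|]; rewrite inE => /and3P[].
have W'k : (#|W'| < k)%N.
  apply: leq_trans Wk; apply: proper_card; rewrite properE W'W /=.
  by apply/fintype.subsetPn; exists u.
suff [v [vD vs]] : exists v, v \in D /\ simplicial W' v.
  exists v; have := DN v vD; rewrite inE => /and3P[vW vu nuv]; split=> //.
  have nbr x : x \in W -> e v x -> x \in W'.
    move=> xW vx; rewrite !inE -implyNb; apply/implyP => xD.
    by rewrite xW xD; apply/exists_inP; exists v => //; rewrite esym.
  apply/simplicialP => x y xW yW vx vy; move/simplicialP: vs; apply=> //; exact: nbr.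
(* If some [s] in [S] misses a vertex of [W'], induction gives a simplicial vertex not adjacent to
   [s]; as [S] is a clique, it lies in [D]. *)
have [/exists_inP[s sS /exists_inP[x xW' /andP[xs nsx]]]|] :=
    boolP [exists s in S, exists x in W', (x != s) && ~~ e s x].
  have [|v [vW' vs nsv vsim]] := IHk W' s x W'k _ xW' xs nsx.
    by rewrite inE sS orbT.
  exists v; split=> //; move: vW'; rewrite inE => /orP[//|vS].
  by move: nsv; rewrite Scl // eq_sym.
rewrite negb_exists_in => /forall_inP Sadj.
have {}Sadj s x : s \in S -> x \in W' -> x != s -> e s x.
  move=> sS xW' xs; have := Sadj s sS; rewrite negb_exists_in.
  by move=> /forall_inP/(_ x xW'); rewrite xs negbK.
(* Now [S] is adjacent to all of [W'], so a vertex not adjacent to some [d] in [D] again lies in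
   [D]. *)
have [/exists_inP[d dD /exists_inP[x xW' /andP[xd ndx]]]|] :=
    boolP [exists s in D, exists x in W', (x != s) && ~~ e s x].
  have dW' : d \in W' by rewrite inE dD.
  have [v [vW' vd ndv vsim]] := IHk W' d x W'k dW' xW' xd ndx.
  exists v; split=> //; move: vW'; rewrite inE => /orP[//|vS].
  by move: ndv; rewrite esym Sadj // eq_sym.
rewrite negb_exists_in => /forall_inP Dadj.
have {}Dadj s x : s \in D -> x \in W' -> x != s -> e s x.
  move=> sS xW' xs; have := Dadj s sS; rewrite negb_exists_in.
  by move=> /forall_inP/(_ x xW'); rewrite xs negbK.
(* In the remaining case [W'] is a clique. *)
exists w; split=> //; apply/simplicialP => x y xW' yW' _ _ xy.
move: xW'; rewrite inE => /orP[xD|xS]; first by rewrite Dadj // eq_sym.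
by rewrite Sadj // eq_sym.
Qed.

Lemma chordal_simplicial (W : {set V}) u :
  u \in W -> exists2 v, v \in W & simplicial W v.
Proof.
move=> uW.
have [/exists_inP[x xW /exists_inP[y yW /andP[yx nxy]]]|] :=
    boolP [exists x in W, exists y in W, (y != x) && ~~ e x y].
  by have [v []] := chordal_simplicial_nonadjacent xW yW yx nxy; exists v.
rewrite negb_exists_in => /forall_inP adj.
exists u => //; apply/simplicialP => x y xW yW _ _ xy.
have := adj x xW; rewrite negb_exists_in => /forall_inP/(_ y yW).
by rewrite eq_sym xy negbK.
Qed.

End ChordalGraphs.

Local Open Scope classical_set_scope.
Local Open Scope ring_scope.

(** * Sparse positive semidefinite matrices *)

Section QuadraticForms.
Context {R : realType} {m : nat}.
Implicit Types (A : 'M[R]_m) (v : 'cV[R]_m).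

Definition qform A v : R := (v^T *m A *m v) ord0 ord0.

Lemma qformE A v : qform A v = \sum_i \sum_j v i ord0 * A i j * v j ord0.
Proof.
rewrite /qform mxE exchange_big; apply: eq_bigr => j _; rewrite mxE mulr_suml.
by apply: eq_bigr => i _; rewrite !mxE.
Qed.

Lemma qformD A B v : qform (A + B) v = qform A v + qform B v.
Proof. by rewrite /qform mulmxDr mulmxDl mxE. Qed.

Lemma qformZ c A v : qform (c *: A) v = c * qform A v.
Proof. by rewrite /qform -scalemxAr -scalemxAl mxE. Qed.

Lemma qform_rank1 (w : 'cV[R]_m) v : qform (w *m w^T) v = (w^T *m v) ord0 ord0 ^+ 2.
Proof.
rewrite /qform mulmxA -mulmxA [LHS]mxE big_ord1 expr2; congr (_ * _).
by rewrite -[v^T *m w]trmxK trmx_mul trmxK mxE.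
Qed.

Lemma qform_add_delta A v i c : A^T = A ->
  qform A (v + c *: delta_mx i ord0) =
    qform A v + 2 * c * (A *m v) i ord0 + c ^+ 2 * A i i.
Proof.
move=> Asym.
have tr11 (M : 'M[R]_1) : M ord0 ord0 = M^T ord0 ord0 by rewrite mxE.
have dA (u : 'cV[R]_m) :
    ((delta_mx ord0 i : 'rV[R]_m) *m (A *m u)) ord0 ord0 = (A *m u) i ord0.
  by rewrite -rowE mxE.
have Ad : (v^T *m A *m (delta_mx i ord0 : 'cV[R]_m)) ord0 ord0 = (A *m v) i ord0.
  by rewrite [LHS]tr11 !trmx_mul trmx_delta trmxK Asym dA.
have dd : ((delta_mx ord0 i : 'rV[R]_m) *m A *m (delta_mx i ord0 : 'cV[R]_m))
    ord0 ord0 = A i i.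
  by rewrite -mulmxA dA -colE mxE.
rewrite /qform.
have -> : (v + c *: delta_mx i ord0)^T = v^T + c *: (delta_mx ord0 i : 'rV[R]_m).
  by rewrite raddfD /= linearZ /= trmx_delta.
rewrite !(mulmxDl, mulmxDr) -!(scalemxAl, scalemxAr).
have addE (M N : 'M[R]_1) : (M + N) ord0 ord0 = M ord0 ord0 + N ord0 ord0.
  by rewrite mxE.
have scaleE a (M : 'M[R]_1) : (a *: M) ord0 ord0 = a * M ord0 ord0.
  by rewrite mxE.
have dA' : ((delta_mx ord0 i : 'rV[R]_m) *m A *m v) ord0 ord0 = (A *m v) i ord0.
  by rewrite -mulmxA dA.
by rewrite !(addE, scaleE) Ad dd dA'; ring.
Qed.

Lemma qform_sum_ge0 I (r : seq I) (A : I -> 'M[R]_m) v :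
  (forall i, 0 <= qform (A i) v) -> 0 <= qform (\sum_(i <- r) A i) v.
Proof.
move=> hA; elim/big_ind : _ => // [|X Y hX hY].
  by rewrite /qform mulmx0 mul0mx mxE.
by rewrite qformD addr_ge0.
Qed.

Lemma pdmx_conv A B (c : R) : 0 < c -> c <= 1 -> pdmx A -> psdmx B ->
  pdmx (c *: A + (1 - c) *: B).
Proof.
move=> c0 c1 [Asym Apos] [Bsym Bge0]; split=> [|v v0].
  by rewrite linearD !linearZ /= Asym Bsym.
rewrite -/(qform _ _) qformD !qformZ.
apply: ltr_wpDr; first by rewrite mulr_ge0 ?subr_ge0 //; exact: Bge0.
by rewrite mulr_gt0 //; exact: Apos.
Qed.

Lemma psdmx_diag_ge0 A i : psdmx A -> 0 <= A i i.
Proof.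
move=> [Asym Age0]; have := Age0 (delta_mx i ord0).
by rewrite -mulmxA -colE trmx_delta -rowE !mxE.
Qed.

(** When [A i i = 0], the form at [e_j + t e_i] is affine in [t] and nonnegative for all [t], so its
    slope vanishes. *)
Lemma psdmx_diag0 A i j : psdmx A -> A i i = 0 -> A j i = 0.
Proof.
move=> [Asym Age0] Aii.
have Aq t : 0 <= A j j + 2 * t * A j i.
  have := Age0 (delta_mx j ord0 + t *: delta_mx i ord0).
  rewrite -/(qform _ _) qform_add_delta // Aii mulr0 addr0 -colE mxE.
  have -> : A i j = A j i by rewrite -{1}Asym mxE.
  by rewrite /qform -mulmxA -colE trmx_delta -rowE !mxE.
apply/eqP; apply: contraT => Aji.
(* This [t] would give the form the value [-1]. *)
have := Aq (- (A j j + 1) / (2 * A j i)).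
suff -> : A j j + 2 * (- (A j j + 1) / (2 * A j i)) * A j i = -1.
  by rewrite oppr_ge0 ler10.
by field.
Qed.

Lemma psdmx_schur A i : psdmx A -> 0 < A i i ->
  psdmx (A - (A i i)^-1 *: (col i A *m (col i A)^T)).
Proof.
move=> [Asym Age0] Aii; split.
  by rewrite linearB linearZ /= trmx_mul trmxK Asym.
move=> v; rewrite -/(qform _ _) qformD -scaleNr qformZ qform_rank1.
have -> : ((col i A)^T *m v) ord0 ord0 = (A *m v) i ord0.
  by rewrite tr_col Asym -row_mul mxE.
(* The shift minimises the form of [A] along [e_i], and the minimum is the form of the Schur
   complement at [v]. *)
have := Age0 (v + (- (A i i)^-1 * (A *m v) i ord0) *: delta_mx i ord0).
rewrite -/(qform _ _) qform_add_delta //; congr (0 <= _).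
by field; rewrite gt_eqF.
Qed.

End QuadraticForms.

(** * Clique decomposition of positive semidefinite matrices with chordal pattern *)

Section SparseDecomposition.
Context {R : realType} {m : nat} (e : rel 'I_m).
Hypothesis (esym : ssrbool.symmetric e) (eirr : irreflexive e) (che : chordal e).

Definition sparse (T : nmodType) (A : 'M[T]_m) : Prop :=
  forall i j, i != j -> ~~ e i j -> A i j = 0.

Definition supp (w : 'cV[R]_m) : {set 'I_m} := [set j | w j ord0 != 0].

(** Induction on a set [W] containing the indices of all nonzero rows. For [v] simplicial in [W],
    the support of column [v] is a clique, so the rank-one term of the Schur complement has clique
    support and keeps the pattern; the complement vanishes on row [v]. *)
Lemma psdmx_sparse_decomposition (A : 'M[R]_m) : psdmx A -> sparse A ->
  exists ws : seq 'cV[R]_m,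
    A = \sum_(w <- ws) w *m w^T /\ {in ws, forall w, clique e (supp w)}.
Proof.
move=> Apsd Asp.
have [W AW] : exists W : {set 'I_m}, forall i j, A i j != 0 -> i \in W.
  by exists [set: _]%SET => i j _; rewrite finset.inE.
have [k] := ubnP #|W|; elim: k W A AW Apsd Asp => // k IHk W A AW Apsd Asp.
rewrite ltnS => Wk.
have [/pred0P W0|/pred0Pn[u uW]] := boolP (pred0b [in W]).
  exists [::]; split=> //; rewrite big_nil; apply/matrixP => i j; rewrite mxE.
  by apply/eqP; apply: contraT => /AW; have /= -> := W0 i.
have [v vW /simplicialP vs] := chordal_simplicial esym eirr che uW.
have Asym : A^T = A by case: Apsd.
have AsymE i j : A i j = A j i by rewrite -{1}Asym mxE.
have Wvk : (#|W :\ v| < k)%N by move: Wk; rewrite (cardsD1 v) vW.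
(* A zero pivot means a zero column, so [v] leaves [W] without any rank-one term. *)
have [Avv|Avv] := eqVneq (A v v) 0.
  apply: (IHk (W :\ v)) => // i j Aij; rewrite !inE (AW i j) // andbT.
  by apply: contraNneq Aij => ->; rewrite AsymE (psdmx_diag0 _ Apsd Avv).
have {}Avv : 0 < A v v by rewrite lt_def Avv psdmx_diag_ge0.
pose A' := A - (A v v)^-1 *: (col v A *m (col v A)^T).
have A'E i j : A' i j = A i j - (A v v)^-1 * (A i v * A j v).
  by rewrite !mxE big_ord1 !mxE.
have adj i : A i v != 0 -> i != v -> i \in W /\ e v i.
  move=> Aiv iv; split; first exact: AW Aiv.
  by apply: contraNT Aiv => nvi; rewrite Asp // esym.
have acl i j : A i v != 0 -> A j v != 0 -> i != j -> e i j.
  move=> Aiv Ajv.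
  have [-> vj|iv] := eqVneq i v; first by case: (adj j) => //; rewrite eq_sym.
  have [-> |jv ij] := eqVneq j v; first by case: (adj i) => //; rewrite esym.
  have [[iW vi] [jW vj]] := (adj _ Aiv iv, adj _ Ajv jv).
  exact: vs.
have [||ws [A'ws wscl]] := IHk (W :\ v) A' _ (psdmx_schur Apsd Avv) _ Wvk.
- move=> i j; rewrite A'E !inE => A'ij; apply/andP; split.
    apply: contraNneq A'ij => ->; rewrite (AsymE v j) mulrA mulVf ?mul1r ?subrr //.
    by rewrite gt_eqF.
  apply: contraNT A'ij => iW.
  have A0 l : A i l = 0 by apply/eqP; apply: contraNT iW => /AW.
  by rewrite !A0 mul0r mulr0 subrr.
(* No fill-in: a nonzero correction at [(i, j)] would make [i] and [j] adjacent by [acl]. *)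
- move=> i j ij nij; rewrite A'E Asp // sub0r.
  have [->|Aiv] := eqVneq (A i v) 0; first by rewrite mul0r mulr0 oppr0.
  have [->|Ajv] := eqVneq (A j v) 0; first by rewrite !mulr0 oppr0.
  by rewrite acl in nij.
exists ((Num.sqrt (A v v))^-1 *: col v A :: ws); split.
  rewrite big_cons -A'ws linearZ /= -scalemxAl -scalemxAr scalerA.
  rewrite -expr2 exprVn sqr_sqrtr ?ltW // /A'.
  by rewrite addrC subrK.
move=> w; rewrite inE => /predU1P[->|]; last exact: wscl.
apply/forall_inP => i iw; apply/forall_inP => j jw; apply/implyP => ij.
move: iw jw; rewrite !inE !mxE !mulf_eq0 !negb_or => /andP[_ Aiv] /andP[_ Ajv].
exact: acl.
Qed.

End SparseDecomposition.

(** * Sums of squares and quadratic modules *)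

Section SumsOfSquares.
Context {R : realType} {n : nat}.
Implicit Types p q : mpoly n R.

Lemma sosp_sqr p : sosp (p ^+ 2).
Proof. by exists 1%N, (fun=> p); rewrite big_ord1. Qed.

Lemma sosp0 : sosp (0 : mpoly n R).
Proof. by exists 0%N, (fun=> 0); rewrite big_ord0. Qed.

Lemma sosp1 : sosp (1 : mpoly n R).
Proof. by have := sosp_sqr 1; rewrite expr1n. Qed.

Lemma sospD p q : sosp p -> sosp q -> sosp (p + q).
Proof.
move=> [s [h ->]] [s' [h' ->]]; exists (s + s')%N.
exists (fun i => match fintype.split i with inl j => h j | inr j => h' j end).
rewrite big_split_ord; congr (_ + _); apply: eq_bigr => i _.
  by rewrite -[lshift _ _]/(unsplit (inl i)) unsplitK.
by rewrite -[rshift _ _]/(unsplit (inr i)) unsplitK.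
Qed.

Lemma sosp_sum I (r : seq I) (P : pred I) (F : I -> mpoly n R) :
  (forall i, P i -> sosp (F i)) -> sosp (\sum_(i <- r | P i) F i).
Proof. by move=> h; apply: big_ind => //; [exact: sosp0|exact: sospD]. Qed.

Lemma sospM p q : sosp p -> sosp q -> sosp (p * q).
Proof.
move=> [s [h ->]] [s' [h' ->]]; rewrite mulr_suml; apply: sosp_sum => i _.
rewrite mulr_sumr; apply: sosp_sum => j _; rewrite -exprMn; exact: sosp_sqr.
Qed.

Lemma sospC (c : R) : 0 <= c -> sosp (mpolyC n c).
Proof. by move=> c0; rewrite -(sqr_sqrtr c0) rmorphXn; exact: sosp_sqr. Qed.

Lemma sosmxD m (A B : 'M[mpoly n R]_m) : sosmx A -> sosmx B -> sosmx (A + B).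
Proof.
move=> [s [H ->]] [s' [H' ->]]; exists (s + s')%N, (col_mx H H').
by rewrite tr_col_mx mul_row_col.
Qed.

Lemma sosmx0 m : sosmx (0 : 'M[mpoly n R]_m).
Proof. by exists m, 0; rewrite mulmx0. Qed.

Lemma sosmxZ_rank1 m p (u : 'cV[mpoly n R]_m) : sosp p -> sosmx (p *: (u *m u^T)).
Proof.
move=> [s [h ->]]; exists s, (\matrix_(i, j) (h i * u j ord0)).
apply/matrixP => i j; rewrite !mxE big_ord1 mulr_suml; apply: eq_bigr => k _.
by rewrite !mxE; ring.
Qed.

End SumsOfSquares.

(** * Quadratic modules, and preorders with one generator *)

Section QuadraticModule.
Context {R : realType} {n q : nat} (g : 'I_q -> mpoly n R).
Implicit Types p : mpoly n R.

Definition quadmod : set (mpoly n R) :=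
  [set p | exists (s0 : mpoly n R) (s : 'I_q -> mpoly n R),
    [/\ sosp s0, forall j, sosp (s j) & p = s0 + \sum_(j < q) g j * s j]].

Lemma quadmod_sos p : sosp p -> quadmod p.
Proof.
move=> sp; exists p, (fun=> 0); split=> // [_|]; first exact: sosp0.
by rewrite big1 ?addr0 // => j _; rewrite mulr0.
Qed.

Lemma quadmod_gen j s : sosp s -> quadmod (g j * s).
Proof.
move=> ss; exists 0, (fun i => if i == j then s else 0); split=> [|i|].
- exact: sosp0.
- by case: ifP => // _; exact: sosp0.
- rewrite add0r (bigD1 j) //= eqxx big1 ?addr0 // => i /negPf ->.
  by rewrite mulr0.
Qed.

Lemma quadmodD p p' : quadmod p -> quadmod p' -> quadmod (p + p').
Proof.
move=> [a [s [ha hs ->]]] [a' [s' [ha' hs' ->]]].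
exists (a + a'), (fun j => s j + s' j); split=> [|j|]; try exact: sospD.
under [in RHS]eq_bigr do rewrite mulrDr.
by rewrite big_split /= addrACA.
Qed.

Lemma quadmodM s p : sosp s -> quadmod p -> quadmod (s * p).
Proof.
move=> ss [a [f [ha hf ->]]].
exists (s * a), (fun j => s * f j); split=> [|j|]; try exact: sospM.
rewrite mulrDr mulr_sumr; congr (_ + _); apply: eq_bigr => j _.
exact: mulrCA.
Qed.

End QuadraticModule.

Section Preorder.
Context {R : realType} {n : nat} (rho : mpoly n R).

(* With a single generator the quadratic module is closed under products,
   since [rho ^+ 2] is a square. *)
Definition preorder1 : set (mpoly n R) :=
  [set p | exists a b, [/\ sosp a, sosp b & p = a + rho * b]].

Lemma preorder1_sos p : sosp p -> preorder1 p.
Proof.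
by move=> sp; exists p, 0; split=> //; [exact: sosp0|rewrite mulr0 addr0].
Qed.

Lemma preorder1_gen : preorder1 rho.
Proof.
by exists 0, 1; split; [exact: sosp0|exact: sosp1|rewrite mulr1 add0r].
Qed.

Lemma preorder1D p p' : preorder1 p -> preorder1 p' -> preorder1 (p + p').
Proof.
move=> [a [b [ha hb ->]]] [a' [b' [ha' hb' ->]]].
by exists (a + a'), (b + b'); split; [exact: sospD..|ring].
Qed.

Lemma preorder1M p p' : preorder1 p -> preorder1 p' -> preorder1 (p * p').
Proof.
move=> [a [b [ha hb ->]]] [a' [b' [ha' hb' ->]]].
exists (a * a' + rho ^+ 2 * (b * b')), (a * b' + b * a'); split.
- by apply: sospD; [exact: sospM|apply: sospM; [exact: sosp_sqr|exact: sospM]].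
- by apply: sospD; exact: sospM.
- by ring.
Qed.

Lemma preorder1_prod I (r : seq I) (P : pred I) (F : I -> mpoly n R) :
  (forall i, P i -> preorder1 (F i)) -> preorder1 (\prod_(i <- r | P i) F i).
Proof.
move=> h; apply: big_ind => //; last exact: preorder1M.
by apply: preorder1_sos; exact: sosp1.
Qed.

Lemma preorder1X p k : preorder1 p -> preorder1 (p ^+ k).
Proof.
move=> hp; rewrite -[k]card_ord -prodr_const; exact: preorder1_prod.
Qed.

Lemma preorder1Z c p : 0 <= c -> preorder1 p -> preorder1 (c *: p).
Proof.
move=> c0; rewrite -mul_mpolyC; apply: preorder1M; apply: preorder1_sos.
exact: sospC.
Qed.

(** A quadratic module need not be closed under products; this inclusion still brings into it all
    products of elements of [preorder1 rho]. *)
Lemma preorder1_sub_quadmod q (g : 'I_q -> mpoly n R) :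
  quadmod g rho -> preorder1 `<=` quadmod g.
Proof.
move=> hrho p [a [b [ha hb ->]]]; apply: quadmodD; first exact: quadmod_sos.
by rewrite mulrC; exact: quadmodM.
Qed.

End Preorder.

(** * Sparse sum-of-squares certificates without degree bounds *)

Section SparseSOS.
Context {R : realType} {n m q t : nat}.
Variables (g : 'I_q -> mpoly n R) (C : 'I_t -> {set 'I_m}).

Definition sparse_sos : set 'M[mpoly n R]_m :=
  [set F | exists (S0 : forall k, 'M[mpoly n R]_#|C k|)
                  (S : 'I_q -> forall k, 'M[mpoly n R]_#|C k|),
    [/\ F = \sum_(k < t) (cliquemx (C k))^T *m
              (S0 k + \sum_(j < q) g j *: S j k) *m cliquemx (C k),
        forall k, sosmx (S0 k) & forall j k, sosmx (S j k)]].

Lemma sparse_sos0 : sparse_sos 0.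
Proof.
exists (fun=> 0), (fun=> fun=> 0); split=> *; [|exact: sosmx0..].
rewrite big1 // => k _; rewrite big1 ?addr0 ?mulmx0 ?mul0mx // => j _.
by rewrite scaler0.
Qed.

Lemma sparse_sosD F G : sparse_sos F -> sparse_sos G -> sparse_sos (F + G).
Proof.
move=> [S0 [S [-> hS0 hS]]] [S0' [S' [-> hS0' hS']]].
exists (fun k => S0 k + S0' k), (fun j k => S j k + S' j k).
split=> *; [|exact: sosmxD..].
rewrite -big_split /=; apply: eq_bigr => k _.
have -> : S0 k + S0' k + \sum_(j < q) g j *: (S j k + S' j k) =
    (S0 k + \sum_(j < q) g j *: S j k) + (S0' k + \sum_(j < q) g j *: S' j k).
  under eq_bigr do rewrite scalerDr.
  by rewrite big_split /= addrACA.
by rewrite [in RHS]mulmxDr [in RHS]mulmxDl.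
Qed.

Lemma sparse_sos_sum I (r : seq I) (P : pred I) (F : I -> 'M[mpoly n R]_m) :
  (forall i, P i -> sparse_sos (F i)) -> sparse_sos (\sum_(i <- r | P i) F i).
Proof. by move=> h; apply: big_ind => //; [exact: sparse_sos0|exact: sparse_sosD]. Qed.

(** [E_D^T E_D] is the diagonal projection onto the coordinates in [D]. *)
Lemma cliquemx_supported (D : {set 'I_m}) (u : 'cV[mpoly n R]_m) :
  (forall i, i \notin D -> u i ord0 = 0) ->
  (cliquemx D)^T *m (cliquemx D *m u) = u.
Proof.
move=> uD; apply/colP => i; rewrite mxE.
have E (k : 'I_#|D|) : (cliquemx D *m u) k ord0 = u (enum_val k) ord0.
  rewrite mxE (bigD1 (enum_val k)) //= mxE eqxx mul1r big1 ?addr0 // => j jk.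
  by rewrite mxE eq_sym (negPf jk) mul0r.
under eq_bigr do rewrite E !mxE.
have [iD|iD] := boolP (i \in D); last first.
  rewrite uD // big1 // => k _; case: eqP => [ki|_]; last by rewrite mul0r.
  by rewrite -ki enum_valP in iD.
rewrite (bigD1 (enum_rank_in iD i)) //= enum_rankK_in // eqxx mul1r big1 ?addr0 //.
move=> k ki; case: eqP => [ek|_]; last by rewrite mul0r.
by have := enum_valK_in iD k; rewrite ek => rk; rewrite rk eqxx in ki.
Qed.

(** All the weight goes to clique [k]: restricting [u] to [C k] and extending by zero gives [u]
    back, and the multipliers of [p] scale the restricted rank-one matrix. *)
Lemma sparse_sos_rank1 p (u : 'cV[mpoly n R]_m) k :
  quadmod g p -> (forall i, i \notin C k -> u i ord0 = 0) ->
  sparse_sos (p *: (u *m u^T)).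
Proof.
move=> [a [s [ha hs ->]]] uk.
pose U k' := cliquemx (C k') *m u.
exists (fun k' => (if k' == k then a else 0) *: (U k' *m (U k')^T)).
exists (fun j k' => (if k' == k then s j else 0) *: (U k' *m (U k')^T)).
split=> [|k'|j k'].
- rewrite (bigD1 k) //= eqxx [X in _ = _ + X]big1 ?addr0; last first.
    move=> k' k'k; rewrite (negPf k'k) /= scale0r big1 ?addr0 ?mulmx0 ?mul0mx // => j _.
    by rewrite scaler0.
  rewrite (eq_bigr _ (fun j _ => scalerA (g j) (s j) _)).
  rewrite -scaler_suml -scalerDl -scalemxAr -scalemxAl; congr (_ *: _).
  rewrite mulmxA (cliquemx_supported uk) -mulmxA; congr (_ *m _).
  by rewrite -[in LHS](cliquemx_supported uk) trmx_mul trmxK.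
- by apply: sosmxZ_rank1; case: ifP => // _; exact: sosp0.
- by apply: sosmxZ_rank1; case: ifP => // _; exact: sosp0.
Qed.

(** The clique supporting each rank-one term of [A] extends to a maximal one, which is some
    [C k]. *)
Lemma sparse_sos_psd (e : rel 'I_m) p (A : 'M[R]_m) :
  ssrbool.symmetric e -> irreflexive e -> chordal e -> lists_maximal_cliques e C ->
  quadmod g p -> psdmx A -> sparse e A ->
  sparse_sos (p *: map_mx (@mpolyC n R) A).
Proof.
move=> esym eirr che [_ hC] hp Apsd Asp.
have [ws [-> wsC]] := psdmx_sparse_decomposition esym eirr che Apsd Asp.
rewrite big_seq raddf_sum /= scaler_sumr; apply: sparse_sos_sum => w wws.
have [D [Dmax wD]] := maxset_exists (wsC w wws).
have /hC[k kD] := Dmax.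
rewrite map_mxM -map_trmx; apply: (@sparse_sos_rank1 _ _ k) => // i.
rewrite kD mxE => iD; apply/eqP; rewrite mpolyC_eq0; apply: contraNT iD => wi.
by apply: (fintype.subsetP wD); rewrite inE.
Qed.

End SparseSOS.

(** * Bernstein expansion *)

Section UnivariateBernstein.

(** Both sides count the [k]-subsets of [N] points together with an ordered choice of [a] distinct
    points of the subset. *)
Lemma bin_mul_ffact N k a : (a <= k <= N)%N ->
  ('C(N, k) * k ^_ a = N ^_ a * 'C(N - a, k - a))%N.
Proof.
move=> /andP[ak kN]; apply/eqP.
rewrite -(eqn_pmul2r (fact_gt0 (k - a))) -(eqn_pmul2r (fact_gt0 (N - k))).
rewrite -!mulnA (mulnA (k ^_ a)) ffact_fact // bin_fact //.
have -> : (N - k = N - a - (k - a))%N by lia.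
by rewrite bin_fact ?ffact_fact //; lia.
Qed.

(** The [a]-th factorial moment of the binomial law: terms with [k < a] vanish, and after shifting
    [k] by [a] the rest is [(x + y)^(N - a) = 1]. *)
Lemma bernstein_monomial (S : comPzRingType) (x y : S) N a :
  (a <= N)%N -> x + y = 1 ->
  \sum_(k < N.+1) ('C(N, k) * k ^_ a)%:R * (x ^+ k * y ^+ (N - k)) =
    (N ^_ a)%:R * x ^+ a.
Proof.
move=> aN xy.
pose f k := ('C(N, k) * k ^_ a)%:R * (x ^+ k * y ^+ (N - k)).
rewrite -(big_mkord xpredT f) (@big_cat_nat _ _ _ a) //=; last exact: leqW.
rewrite big_nat_cond big1 ?add0r => [|k /andP[/andP[_ ka] _]]; last first.
  by rewrite /f ffact_small // muln0 mul0r.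
rewrite -{1}[a]add0n big_addn subSn // big_mkord.
transitivity ((N ^_ a)%:R * x ^+ a * (y + x) ^+ (N - a)); last first.
  by rewrite addrC xy expr1n mulr1.
rewrite exprDn mulr_sumr; apply: eq_bigr => -[i /= iNa] _.
have {}iNa : (i + a <= N)%N by lia.
rewrite /f bin_mul_ffact ?leq_addl // addnK natrM exprD.
have -> : (N - (i + a) = N - a - i)%N by lia.
by rewrite -mulr_natr; ring.
Qed.

End UnivariateBernstein.

(** * Bernstein coefficients and their distance to the values on the grid *)

Section Bernstein.
Context {R : realType}.

(** Taken in any commutative algebra, so that [x] may itself be a polynomial. *)
Definition bernpoly (S : comAlgType R) N (k : nat) (x : S) : S :=
  ('C(N, k))%:R *: (x ^+ k * (1 - x) ^+ (N - k)).

(** The [k]-th Bernstein coefficient of degree [N] of the monomial of exponent [a], close to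
    [(k / N)^a]. *)
Definition ffact_ratio N k a : R := (k ^_ a)%:R / (N ^_ a)%:R.

Lemma bernpoly_monomial (S : comAlgType R) (x : S) N a : (a <= N)%N ->
  x ^+ a = \sum_(k < N.+1) ffact_ratio N k a *: bernpoly N k x.
Proof.
move=> aN; have Na : (N ^_ a)%:R != 0 :> R by rewrite pnatr_eq0 -lt0n ffact_gt0.
apply: (scalerI Na).
have -> : (N ^_ a)%:R *: x ^+ a = (N ^_ a)%:R * x ^+ a.
  by rewrite scaler_nat mulr_natl.
rewrite -(@bernstein_monomial _ x (1 - x) N a) //; last by rewrite addrC subrK.
rewrite scaler_sumr; apply: eq_bigr => k _.
rewrite /bernpoly !scalerA mulr_natl -scaler_nat; congr (_ *: _).
by rewrite natrM /ffact_ratio; field.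
Qed.

(** Telescoping: replacing one factor at a time costs at most the change of that factor, the others
    being in [[0, 1]]. *)
Lemma prod_dist_le I (r : seq I) (u z : I -> R) :
  (forall i, 0 <= u i <= 1) -> (forall i, 0 <= z i <= 1) ->
  `|\prod_(i <- r) u i - \prod_(i <- r) z i| <= \sum_(i <- r) `|u i - z i|.
Proof.
move=> u01 z01; have pz s : 0 <= \prod_(i <- s) z i <= 1.
  elim: s => [|i s]; rewrite ?big_nil ?big_cons ?ler01 ?lexx //.
  have /andP[z0 z1] := z01 i; move=> /andP[p0 p1].
  by rewrite mulr_ge0 //= mulr_ile1.
elim: r => [|i r IHr]; first by rewrite !big_nil subrr normr0.
rewrite !big_cons; set U := \prod_(_ <- _) _; set Z := \prod_(_ <- _) _.
have /andP[Z0 Z1] : 0 <= Z <= 1 := pz r; have /andP[u0 u1] := u01 i.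
have -> : u i * U - z i * Z = (u i - z i) * Z + u i * (U - Z) by ring.
apply: le_trans (ler_normD _ _) _; rewrite !normrM (ger0_norm Z0) (ger0_norm u0).
apply: lerD; first by rewrite ler_piMr.
by apply: le_trans IHr; rewrite ler_piMl.
Qed.

Lemma ratio01 k N : (k <= N)%N -> 0 <= (k%:R / N%:R : R) <= 1.
Proof.
move=> kN; rewrite divr_ge0 //=; have [->|N0] := posnP N.
  by rewrite invr0 mulr0 ler01.
by rewrite ler_pdivrMr ?mul1r ?ler_nat // ltr0n.
Qed.

Lemma ffact_ratioE N k a : ffact_ratio N k a = \prod_(i < a) ((k - i)%:R / (N - i)%:R).
Proof. by rewrite prodf_div -!natr_prod -!ffact_prod. Qed.

Lemma ffact_ratio01 N k a : (k <= N)%N -> 0 <= ffact_ratio N k a <= 1.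
Proof.
move=> kN; rewrite ffact_ratioE; elim/big_ind: _ => [|x y|i _].
- by rewrite ler01 lexx.
- by move=> /andP[x0 x1] /andP[y0 y1]; rewrite mulr_ge0 //= mulr_ile1.
- by apply: ratio01; lia.
Qed.

(** Each of the [a] factors [(k - i) / (N - i)] is within [i / N], hence [a / N], of [k / N]. *)
Lemma ffact_ratio_dist N k a : (k <= N)%N -> (a <= N)%N ->
  `|ffact_ratio N k a - (k%:R / N%:R) ^+ a| <= (a * a)%:R / N%:R.
Proof.
move=> kN aN; rewrite ffact_ratioE.
have -> : (k%:R / N%:R) ^+ a = \prod_(i < a) (k%:R / N%:R) :> R.
  by rewrite prodr_const card_ord.
apply: le_trans (prod_dist_le _ _ _) _ => [i|i|].
- by apply: ratio01; lia.
- exact: ratio01.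
apply: (@le_trans _ _ (\sum_(i < a) a%:R / N%:R)); last first.
  by rewrite sumr_const card_ord -[leLHS]mulr_natl natrM mulrA.
apply: ler_sum => -[i /= ia] _.
have N0 : 0 < N%:R :> R by rewrite ltr0n; lia.
have Ni0 : 0 < (N - i)%:R :> R by rewrite ltr0n; lia.
apply: (@le_trans _ _ (i%:R / N%:R)); last first.
  by rewrite ler_pM2r ?invr_gt0 // ler_nat ltnW.
(* For [k < i] the truncated difference is [0], and the error [k / N] is still below [i / N]. *)
have [ik|ki] := leqP i k; last first.
  have -> : (k - i = 0)%N by lia.
  rewrite mul0r sub0r normrN ger0_norm ?divr_ge0 //.
  by rewrite ler_pM2r ?invr_gt0 // ler_nat ltnW.
have iN : (i <= N)%N by lia.
rewrite distrC.
have -> : k%:R / N%:R - (k - i)%:R / (N - i)%:R =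
          (i%:R / N%:R) * ((N - k)%:R / (N - i)%:R) :> R.
  have kE : k%:R = i%:R + (k - i)%:R :> R by rewrite -natrD subnKC.
  have NE : N%:R = i%:R + (k - i)%:R + (N - k)%:R :> R.
    by rewrite -!natrD; congr _%:R; lia.
  have NiE : (N - i)%:R = (k - i)%:R + (N - k)%:R :> R.
    by rewrite -!natrD; congr _%:R; lia.
  rewrite NiE kE NE; by field; rewrite -NiE -NE !lt0r_neq0.
have /andP[r0 r1] : 0 <= ((N - k)%:R / (N - i)%:R : R) <= 1 by apply: ratio01; lia.
rewrite ger0_norm ?mulr_ge0 ?invr_ge0 //.
by rewrite ler_piMr // mulr_ge0 ?invr_ge0.
Qed.


Context {n : nat}.
Implicit Types (al : multinom n) (p : mpoly n R).

Definition multi_ratio N (ka : {ffun 'I_n -> 'I_N.+1}) al : R :=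
  \prod_(i < n) ffact_ratio N (ka i) (al i).

Definition bern_coef N (ka : {ffun 'I_n -> 'I_N.+1}) p : R :=
  \sum_(al <- msupp p) mcoeff al p * multi_ratio ka al.

Definition grid N (ka : {ffun 'I_n -> 'I_N.+1}) : 'I_n -> R :=
  fun i => (ka i)%:R / N%:R.

Lemma leq_mnm_msize p al i : al \in msupp p -> (al i <= msize p)%N.
Proof.
move=> /msize_mdeg_lt /ltnW; apply: leq_trans.
by rewrite mdegE (bigD1 i) //= leq_addr.
Qed.

(** Monomials factor over the variables, so the univariate expansions multiply out. Composing with
    [ts] makes room for Bernstein polynomials in affine functions of the variables. *)
Lemma comp_mpoly_bernstein n' p (ts : n.-tuple (mpoly n' R)) N :
  (msize p <= N)%N ->
  comp_mpoly ts p = \sum_ka bern_coef ka p *: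
     \prod_(i < n) bernpoly N (ka i : 'I_N.+1) (tnth ts i).
Proof.
move=> pN; rewrite comp_mpolyE /bern_coef.
under [RHS]eq_bigr do rewrite scaler_suml.
rewrite exchange_big /= !big_seq; apply: eq_bigr => al alp.
under [RHS]eq_bigr do rewrite -scalerA.
rewrite -scaler_sumr; congr (_ *: _).
transitivity (\prod_(i < n) \sum_(k < N.+1)
    ffact_ratio N k (al i) *: bernpoly N k (tnth ts i)).
  apply: eq_bigr => i _; apply: bernpoly_monomial.
  exact: leq_trans (leq_mnm_msize i alp) pN.
rewrite bigA_distr_bigA; apply: eq_bigr => ka _.
by rewrite scaler_prod.
Qed.

Lemma bern_coef_dist p :
  exists2 K : R, 0 <= K & forall N (ka : {ffun 'I_n -> 'I_N.+1}), (msize p <= N)%N ->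
    `|bern_coef ka p - meval (grid ka) p| <= K / N%:R.
Proof.
exists (\sum_(al <- msupp p) `|mcoeff al p| * \sum_(i < n) (al i * al i)%:R).
  by apply: sumr_ge0 => al _; rewrite mulr_ge0 ?sumr_ge0.
move=> N ka pN; rewrite mevalE /bern_coef -sumrB.
apply: le_trans (ler_norm_sum _ _ _) _; rewrite mulr_suml !big_seq.
apply: ler_sum => al alp; rewrite -mulrBr normrM -mulrA ler_wpM2l //.
have kN i : (ka i <= N)%N by rewrite -ltnS.
apply: le_trans (prod_dist_le _ _ _) _ => [i|i|].
- exact: ffact_ratio01.
- have /andP[g0 g1] : 0 <= grid ka i <= 1 by exact: ratio01.
  by rewrite exprn_ge0 //= exprn_ile1.
rewrite mulr_suml; apply: ler_sum => i _; apply: ffact_ratio_dist => //.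
exact: leq_trans (leq_mnm_msize i alp) pN.
Qed.

End Bernstein.

(** * From the semialgebraic set to the box *)

Section PeakFunction.
Context {R : realType}.
Implicit Types y d : R.

Lemma bernoulli_le y k : 0 <= y -> 1 + k%:R * y <= (1 + y) ^+ k.
Proof.
move=> y0; elim: k => [|k IHk]; first by rewrite mul0r addr0 expr0.
rewrite exprS; apply: (@le_trans _ _ ((1 + y) * (1 + k%:R * y))); last first.
  by rewrite ler_wpM2l // addr_ge0.
have k0 : 0 <= k%:R :> R by [].
by rewrite -natr1; nra.
Qed.

(** The correction term in [y = g_j / M]: at most [1 / (k + 1)] for [y <= 1], and tending to minus
    infinity with [k] at each negative [y]. *)
Definition peak k y : R := y * ((1 - y) ^+ k) ^+ 2.

(** For [0 <= y <= 1], Bernoulli gives [(1 - y)^k (1 + k y) <= (1 - y^2)^k <= 1], while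
    [(k + 1) y <= 1 + k y]. *)
Lemma peak_le k y : y <= 1 -> peak k y <= k.+1%:R^-1.
Proof.
move=> y1; have [y0|y0] := ltP y 0.
  apply: (@le_trans _ _ 0); last by rewrite invr_ge0.
  by rewrite mulr_le0_ge0 ?sqr_ge0 // ltW.
rewrite -[leRHS]mul1r ler_pdivlMr ?ltr0Sn // /peak.
set z := (1 - y) ^+ k.
have z0 : 0 <= z by rewrite exprn_ge0 // subr_ge0.
have z1 : z <= 1 by rewrite exprn_ile1 ?subr_ge0 // lerBlDr lerDl.
have zy : z * (1 + k%:R * y) <= 1.
  apply: (@le_trans _ _ (z * (1 + y) ^+ k)).
    by rewrite ler_wpM2l // bernoulli_le.
  by rewrite -exprMn exprn_ile1 ?mulr_ge0 ?subr_ge0 ?addr_ge0 //; nra.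
have k0 : 0 <= k%:R :> R by [].
have yk : y * k.+1%:R <= 1 + k%:R * y by rewrite -natr1; nra.
apply: le_trans zy; apply: (@le_trans _ _ (z * (y * k.+1%:R))); last first.
  by rewrite ler_wpM2l.
have : 0 <= y * k.+1%:R by rewrite mulr_ge0.
move=> yk0; rewrite [leLHS](_ : _ = (y * k.+1%:R) * z ^+ 2); last by ring.
rewrite mulrC ler_wpM2r // expr2 ler_piMr //.
Qed.

Lemma peak_le_neg k y d : 0 < d -> y <= - d -> peak k y <= - (k%:R * d ^+ 2).
Proof.
move=> d0 yd; rewrite /peak.
have zk : 1 + k%:R * d <= (1 - y) ^+ k.
  apply: le_trans (bernoulli_le _ (ltW d0)) _.
  by apply: lerXn2r; rewrite ?nnegrE; lra.
set z := _ ^+ k in zk *.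
have kd : 0 <= k%:R * d by rewrite mulr_ge0 // ltW.
have zz : 1 + k%:R * d <= z ^+ 2 by rewrite expr2 -[leLHS]mul1r; apply: ler_pM; lra.
move: (z ^+ 2) zz => w zz.
apply: (@le_trans _ _ (- d * w)); first by apply: ler_wpM2r; lra.
rewrite mulNr lerN2; apply: (@le_trans _ _ (d * (1 + k%:R * d))).
  by rewrite expr2 mulrDr mulr1 mulrCA lerDr ltW.
by apply: ler_wpM2l; lra.
Qed.

End PeakFunction.

(** * Continuity of evaluation and compactness of the box and the sphere *)

Section Continuity.
Context {R : realType}.

Lemma continuous_sum (T : topologicalType) I (r : seq I) (f : I -> T -> R) :
  (forall i, continuous (f i)) -> continuous (fun x => \sum_(i <- r) f i x).
Proof.
move=> cf; elim: r => [|i r IHr] x.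
  under eq_fun do rewrite big_nil; exact: cst_continuous.
under eq_fun do rewrite big_cons.
exact: (cvgD (cf i x) (IHr x)).
Qed.

Lemma continuous_prod (T : topologicalType) I (r : seq I) (f : I -> T -> R) :
  (forall i, continuous (f i)) -> continuous (fun x => \prod_(i <- r) f i x).
Proof.
move=> cf; elim: r => [|i r IHr] x.
  under eq_fun do rewrite big_nil; exact: cst_continuous.
under eq_fun do rewrite big_cons.
exact: (cvgM (cf i x) (IHr x)).
Qed.

Lemma continuous_mul (T : topologicalType) (f h : T -> R) :
  continuous f -> continuous h -> continuous (fun x => f x * h x).
Proof. by move=> cf ch x; exact: (cvgM (cf x) (ch x)). Qed.

Lemma evalp_continuous n (p : mpoly n R) : continuous (fun x => evalp x p).
Proof.
rewrite /evalp; under eq_fun do rewrite mevalE.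
apply: continuous_sum => al; apply: continuous_mul => [x|]; first exact: cst_continuous.
apply: continuous_prod => i x.
apply: (cvg_comp (fun x : 'rV[R]_n => x ord0 i) (fun y => y ^+ al i)).
  exact: coord_continuous.
exact: exprn_continuous.
Qed.

Lemma qform_evalmx_continuous n m (F : 'M[mpoly n R]_m) :
  continuous (fun xv : 'rV[R]_n * 'rV[R]_m => qform (evalmx xv.1 F) xv.2^T).
Proof.
under eq_fun do rewrite qformE.
apply: continuous_sum => i; apply: continuous_sum => j.
have cv k : continuous (fun xv : 'rV[R]_n * 'rV[R]_m => (xv.2^T : 'cV[R]_m) k ord0).
  under eq_fun do rewrite mxE.
  move=> xv; apply: (cvg_comp (fun yv : 'rV[R]_n * 'rV[R]_m => yv.2) (fun v => v ord0 k)).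
    exact: cvg_snd.
  exact: coord_continuous.
apply: continuous_mul => //; apply: continuous_mul => //.
under eq_fun do rewrite mxE.
move=> xv.
apply: (cvg_comp (fun yv : 'rV[R]_n * 'rV[R]_m => yv.1) (fun y => evalp y (F i j))).
  exact: cvg_fst.
exact: evalp_continuous.
Qed.

Definition sqnorm m (v : 'cV[R]_m) : R := \sum_i v i ord0 ^+ 2.

Definition box n (r : R) : set 'rV[R]_n := [set x | forall i, - r <= x ord0 i <= r].

Arguments box n r : clear implicits.

Lemma box_compact n r : compact (box n r).
Proof.
have -> : box n r = [set x | forall i, `[- r, r]%classic (x ord0 i)].
  by apply/seteqP; split => x h i; have := h i; rewrite /= in_itv.
by apply: (@rV_compact R n (fun=> `[- r, r]%classic)) => i; exact: segment_compact.
Qed.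

Lemma sphere_compact m : compact [set v : 'rV[R]_m | sqnorm v^T = 1].
Proof.
have -> : [set v : 'rV[R]_m | sqnorm v^T = 1] =
    box m 1 `&` [set v : 'rV[R]_m | sqnorm v^T = 1].
  apply/seteqP; split => [v /= v1|v []//]; split=> // i.
  have vi1 : `|v ord0 i| ^+ 2 <= 1.
    rewrite real_normK ?num_real // -v1 /sqnorm (bigD1 i) //= mxE lerDl.
    by apply: sumr_ge0 => k _; exact: sqr_ge0.
  by rewrite -ler_norml -(@ler_pXn2r _ 2) ?nnegrE // expr1n.
apply: compact_closedI; first exact: box_compact.
have : continuous (fun v : 'rV[R]_m => sqnorm v^T).
  rewrite /sqnorm; under eq_fun do under eq_bigr do rewrite mxE expr2.
  apply: continuous_sum => i; apply: continuous_mul; exact: coord_continuous.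
by move=> /continuous_closedP/(_ _ (@closed_eq _ 1)).
Qed.

Lemma evalp_bounded n (p : mpoly n R) r :
  exists2 M, 0 <= M & forall x, box n r x -> `|evalp x p| <= M.
Proof.
have /compact_bounded[M [_ hM]] := continuous_compact
  (continuous_subspaceT (evalp_continuous (p:=p))) (@box_compact n r).
exists (`|M| + 1) => [|x xr]; first by rewrite addr_ge0.
apply: (hM (`|M| + 1)); last by exists x.
by rewrite (le_lt_trans (ler_norm M)) // ltrDl.
Qed.

End Continuity.
Arguments box {R} n r _.

(** * From positivity on the semialgebraic set to positivity on the box *)

Section LocalToGlobal.
Context {R : realType} {n m q : nat}.
Variables (g : 'I_q -> mpoly n R) (F : 'M[mpoly n R]_m) (r : R).

Lemma qform_scalar_mx c (v : 'cV[R]_m) : qform c%:M v = c * sqnorm v.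
Proof.
rewrite qformE /sqnorm mulr_sumr; apply: eq_bigr => i _.
rewrite (bigD1 i) //= big1 ?addr0 => [|j /negPf ji]; rewrite !mxE ?eqxx ?mulr1n; first ring.
by rewrite eq_sym ji mulr0n mulr0 mul0r.
Qed.

Lemma qformZr A (c : R) (v : 'cV[R]_m) : qform A (c *: v) = c ^+ 2 * qform A v.
Proof.
rewrite !qformE mulr_sumr; apply: eq_bigr => i _; rewrite mulr_sumr.
by apply: eq_bigr => j _; rewrite !mxE; ring.
Qed.

Lemma sqnormZ (c : R) (v : 'cV[R]_m) : sqnorm (c *: v) = c ^+ 2 * sqnorm v.
Proof. by rewrite -[LHS]mul1r -[X in _ = _ * X]mul1r -!qform_scalar_mx qformZr. Qed.

Lemma sqnorm_ge0 (v : 'cV[R]_m) : 0 <= sqnorm v.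
Proof. by apply: sumr_ge0 => i _; exact: sqr_ge0. Qed.

Lemma sqnorm_eq0 (v : 'cV[R]_m) : sqnorm v = 0 -> v = 0.
Proof.
move=> /eqP; rewrite psumr_eq0 => [/allP v0|i _]; last exact: sqr_ge0.
apply/colP => i; rewrite mxE; apply/eqP; rewrite -sqrf_eq0.
exact: v0 (mem_index_enum i).
Qed.

Lemma qform_ge_of_sphere A (c : R) :
  (forall v : 'cV[R]_m, sqnorm v = 1 -> c <= qform A v) ->
  forall v, c * sqnorm v <= qform A v.
Proof.
move=> hA v; have [v0|v0] := eqVneq (sqnorm v) 0.
  rewrite v0 mulr0 (sqnorm_eq0 v0) -(scale0r (0 : 'cV[R]_m)) qformZr expr0n /=.
  by rewrite mul0r.
have vgt0 : 0 < sqnorm v by rewrite lt_def v0 sqnorm_ge0.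
have := hA ((Num.sqrt (sqnorm v))^-1 *: v).
rewrite sqnormZ qformZr exprVn sqr_sqrtr ?(ltW vgt0) // mulVf // => /(_ erefl).
by rewrite mulrC ler_pdivlMr.
Qed.

Lemma qform_evalmx_shift x (h : mpoly n R) (v : 'cV[R]_m) :
  qform (evalmx x (F - h%:M)) v = qform (evalmx x F) v - evalp x h * sqnorm v.
Proof.
rewrite /evalmx /evalp map_mxB map_scalar_mx qformD -scaleN1r qformZ.
by rewrite qform_scalar_mx mulN1r.
Qed.

(* Near [K] the correction [sum_j g_j s_j] is at most [O(1/k)], elsewhere on the
   box it tends to [-oo] with [k]. *)
Lemma psd_on_box_of_pd_on_semialg :
  (forall x, semialg g x -> pdmx (evalmx x F)) ->
  exists (s : 'I_q -> mpoly n R) (eps : R),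
    [/\ 0 < eps, forall j, sosp (s j) & forall x, box n r x -> forall v,
      eps * sqnorm v <= qform (evalmx x (F - (\sum_(j < q) g j * s j)%:M)) v].
Proof.
move=> Fpd.
have [M [M0 gM]] : exists M : R, 0 < M /\
    forall j x, box n r x -> `|evalp x (g j)| <= M.
  have /choice[B gB] j := (let: ex_intro2 B B0 hB := evalp_bounded (g j) r in
    ex_intro (fun B => 0 <= B /\ forall x, box n r x -> `|evalp x (g j)| <= B)
      B (conj B0 hB)).
  have B0 j : 0 <= B j by case: (gB j).
  exists (1 + \sum_(j < q) B j); split; first by rewrite ltr_wpDr ?sumr_ge0.
  move=> j x xr; apply: le_trans ((gB j).2 x xr) _.
  by rewrite (bigD1 j) //= addrCA lerDl addr_ge0 // sumr_ge0.
(* Chosen so that [g j * s k j] evaluates to [peak k (g_j / M)], where [g_j / M <= 1] on the box. *)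
pose s k j : mpoly n R := mpolyC n M^-1 * ((1 - mpolyC n M^-1 * g j) ^+ k) ^+ 2.
pose h k x := \sum_(j < q) peak k (evalp x (g j) / M).
have hE k x : evalp x (\sum_(j < q) g j * s k j) = h k x.
  rewrite /h /evalp raddf_sum; apply: eq_bigr => j _ /=.
  rewrite /s /peak !rmorphM !rmorphXn rmorphB rmorphM rmorph1 /= mevalC.
  by rewrite [_ / M]mulrC; ring.
have ssos k j : sosp (s k j).
  by apply: sospM; [apply: sospC; rewrite invr_ge0 ltW|exact: sosp_sqr].
have yle j x : box n r x -> evalp x (g j) / M <= 1.
  move=> xr; rewrite ler_pdivrMr // mul1r.
  by apply: le_trans (gM j x xr); exact: ler_norm.
have cA := compact_setX (@box_compact R n r) (@sphere_compact R m).
(* Neighbourhoods of points of the box spill outside it, where [M] bounds nothing; hence the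
   guard. *)
pose P k (xv : 'rV[R]_n * 'rV[R]_m) := box n r xv.1 ->
  k.+1%:R^-1 < qform (evalmx xv.1 F) xv.2^T - h k xv.1.
(* By compactness of box times sphere, it suffices to treat each point on a neighbourhood and for
   all large [k]. *)
have /compact_near_coveringP/(_ nat \oo P _)[|N _ hN] := cA; last first.
  exists (s N), N.+1%:R^-1; split=> // x xr; apply: qform_ge_of_sphere => v v1.
  rewrite qform_evalmx_shift hE v1 mulr1 -[v]trmxK ltW //.
  by apply: (hN N _ (x, v^T)) => //=; rewrite trmxK.
move=> [x v] [/= xr v1].
have kpos k : 0 < k.+1%:R :> R by [].
have fc := @qform_evalmx_continuous R n m F (x, v).
(* If the form is positive at [(x, v)], it stays above [eta] nearby, while the correction plus the
   margin is at most [(q + 1) / (k + 1)]. *)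
have [f0|f0] := ltP 0 (qform (evalmx x F) v^T).
  pose eta := qform (evalmx x F) v^T / 2.
  have eta0 : 0 < eta by rewrite divr_gt0.
  have etaf : eta < qform (evalmx x F) v^T.
    by rewrite /eta ltr_pdivrMr // mulr_natr mulr2n ltrDl.
  exists ([set xv | eta < qform (evalmx xv.1 F) xv.2^T],
          [set k | (q%:R + 1) / eta < k%:R]).
    by split; [exact: (cvgr_gt _ fc)|exact: nbhs_infty_gtr].
  move=> [[x' v'] k] [/= fx' kq] x'r.
  have hk : h k x' <= q%:R / k.+1%:R.
    apply: (@le_trans _ _ (\sum_(j < q) k.+1%:R^-1)).
      by apply: ler_sum => j _; apply: peak_le; exact: yle.
    by rewrite sumr_const card_ord mulr_natl.
  rewrite ltrBrDl; apply: le_lt_trans fx'.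
  apply: le_trans (lerD hk (lexx _)) _; rewrite -[X in _ + X]mul1r -mulrDl.
  rewrite ler_pdivrMr // mulrC -ler_pdivrMr //; apply: le_trans (ltW kq) _.
  by rewrite ler_nat.
(* Otherwise [x] lies outside the semialgebraic set, [F] being positive definite on it and [v]
   nonzero. *)
have [j gj] : exists j, evalp x (g j) < 0.
  apply: contrapT => /forallNP gx; have /Fpd[_ /(_ v^T)] : semialg g x.
    by move=> j; rewrite leNgt; apply/negP; exact: gx.
  rewrite -/(qform _ _) => fpos.
  suff /fpos : v^T != 0 by rewrite ltNge f0.
  apply: contra_eq_neq v1 => /= ->; rewrite /sqnorm big1 => [|i _].
    by rewrite eq_sym oner_neq0.
  by rewrite mxE expr0n.
(* Half the depth of [g_j / M] at [x], so that [g_j / M < - d] persists nearby. That term is then at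
   most [- k d^2], which outweighs the others, each at most [1]. *)
pose d := - evalp x (g j) / M / 2.
have d0 : 0 < d by rewrite !divr_gt0 // oppr_gt0.
pose c := qform (evalmx x F) v^T - 1.
exists ([set xv | c < qform (evalmx xv.1 F) xv.2^T] `&`
        [set xv | evalp xv.1 (g j) < - (d * M)],
        [set k | (q%:R + 1 - c) / d ^+ 2 < k%:R]).
  split; last exact: nbhs_infty_gtr.
  apply: filterI; first by apply: (cvgr_gt _ fc); rewrite /c ltrBlDr ltrDl.
  have gc : evalp yv.1 (g j) @[yv --> (x, v)] --> evalp x (g j).
    apply: (cvg_comp (fun yv : 'rV[R]_n * 'rV[R]_m => yv.1) (fun y => evalp y (g j))).
      exact: cvg_fst.
    exact: evalp_continuous.
  apply: (cvgr_lt _ gc).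
  by rewrite /d mulrAC divfK ?gt_eqF // mulNr opprK; lra.
move=> [[x' v'] k] [/= [fx' gx'] kq] x'r.
have k1 : k.+1%:R^-1 <= 1 :> R by rewrite invf_le1 // ler1n.
have hk : h k x' <= q%:R - k%:R * d ^+ 2.
  rewrite /h (bigD1 j) //= addrC; apply: lerD.
    apply: (@le_trans _ _ (\sum_(i < q | i != j) 1)).
      by apply: ler_sum => i _; apply: le_trans k1; apply: peak_le; exact: yle.
    by rewrite sumr_const ler_nat; apply: leq_trans (max_card _) _; rewrite card_ord.
  by apply: peak_le_neg => //; rewrite ler_pdivrMr // mulNr ltW.
have aux (X Y Z T Q : R) : c < X -> Z <= Q - T -> Y <= 1 -> Q + 1 - c < T ->
    Y < X - Z by lra.
by move: kq; rewrite ltr_pdivrMr ?exprn_gt0 //; exact: aux fx' hk k1.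
Qed.

End LocalToGlobal.

(** * The sparse matrix Positivstellensatz *)

Section SparsePositivstellensatz.
Context {R : realType} {n m q t : nat}.
Variables (g : 'I_q -> mpoly n R) (C : 'I_t -> {set 'I_m}) (e : rel 'I_m).

Lemma qform_bound (D K : 'M[R]_m) (v : 'cV[R]_m) :
  (forall i j, `|D i j| <= K i j) ->
  `|qform D v| <= (\sum_i \sum_j K i j) * sqnorm v.
Proof.
move=> DK; rewrite qformE mulr_suml; apply: le_trans (ler_norm_sum _ _ _) _.
apply: ler_sum => i _; rewrite mulr_suml; apply: le_trans (ler_norm_sum _ _ _) _.
apply: ler_sum => j _; rewrite mulrAC mulrC normrM; apply: ler_pM => //.
have v2 k : v k ord0 ^+ 2 <= sqnorm v.
  by rewrite /sqnorm (bigD1 k) //= lerDl sumr_ge0 // => *; exact: sqr_ge0.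
have := v2 i; have := v2 j; rewrite ler_norml.
have := sqr_ge0 (v i ord0 + v j ord0); have := sqr_ge0 (v i ord0 - v j ord0).
by move: (v i ord0) (v j ord0) (sqnorm v) => a b c *; apply/andP; split; nra.
Qed.

(** With [c = 1] for [x] and [c = -1] for [1 - x], use [(r + c x_i) / (2 r) = ((r + c x_i)^2 + (r^2
    - x_i^2)) / (4 r^2)], where [r^2 - x_i^2] is [rho] plus the squares of the other variables. *)
Lemma preorder1_box (r : R) (i : 'I_n) : 0 < r ->
  let rho := mpolyC n (r ^+ 2) - normsq in
  let x := mpolyC n 2^-1 + (2 * r)^-1 *: mpolyX R (mnm1 i) in
  preorder1 rho x /\ preorder1 rho (1 - x).
Proof.
move=> r0 rho x.
have sq (c : R) : c ^+ 2 = 1 -> preorder1 rho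
    (mpolyC n 2^-1 + mpolyC n (c * (2 * r)^-1) * mpolyX R (mnm1 i)).
  move=> c1.
  have rhoi : preorder1 rho (mpolyC n (r ^+ 2) - mpolyX R (mnm1 i) ^+ 2).
    have -> : mpolyC n (r ^+ 2) - mpolyX R (mnm1 i) ^+ 2 =
        rho + \sum_(j < n | j != i) mpolyX R (mnm1 j) ^+ 2.
      by rewrite /rho /normsq (bigD1 i) //= opprD addrA addrNK.
    apply: preorder1D; first exact: preorder1_gen.
    by apply: preorder1_sos; apply: sosp_sum => j _; exact: sosp_sqr.
  have -> : mpolyC n 2^-1 + mpolyC n (c * (2 * r)^-1) * mpolyX R (mnm1 i) =
     (4 * r ^+ 2)^-1 *: ((mpolyC n r + mpolyC n c * mpolyX R (mnm1 i)) ^+ 2 +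
        (mpolyC n (r ^+ 2) - mpolyX R (mnm1 i) ^+ 2)).
    rewrite -[RHS]mul_mpolyC.
    have c1' : mpolyC n c ^+ 2 = 1 by rewrite -rmorphXn c1 rmorph1.
    have -> : (mpolyC n r + mpolyC n c * mpolyX R (mnm1 i)) ^+ 2 +
        (mpolyC n (r ^+ 2) - mpolyX R (mnm1 i) ^+ 2) =
        mpolyC n (2 * r ^+ 2) + mpolyC n (2 * r * c) * mpolyX R (mnm1 i).
      rewrite !rmorphM rmorph_nat sqrrD exprMn c1'; ring.
    have E1 : (4 * r ^+ 2)^-1 * (2 * r ^+ 2) = 2^-1 by field; exact: lt0r_neq0.
    have E2 : (4 * r ^+ 2)^-1 * (2 * r * c) = c * (2 * r)^-1.
      by field; exact: lt0r_neq0.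
    by rewrite mulrDr [X in _ = _ + X]mulrA -!mpolyCM E1 E2.
  apply: preorder1Z; first by rewrite invr_ge0 mulr_ge0 ?sqr_ge0.
  by apply: preorder1D => //; apply: preorder1_sos; exact: sosp_sqr.
have -> : x = mpolyC n 2^-1 + mpolyC n (1 * (2 * r)^-1) * mpolyX R (mnm1 i).
  by rewrite mul1r mul_mpolyC.
split; first by apply: sq; rewrite expr1n.
have := sq (-1) (sqrr_sign _ 1); congr (preorder1 _ _).
rewrite mulN1r mul1r rmorphN mulNr opprD addrA; congr (_ - _).
apply/eqP; rewrite eq_sym subr_eq -mpolyCD -mpolyC1; apply/eqP; congr mpolyC.
by field.
Qed.

(** The given radius may be zero; adding the square [1] to both sides turns [r^2] into [r^2 + 1]. *)
Lemma quadmod_ball : archimedean_condition g ->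
  exists2 r : R, 0 < r & quadmod g (mpolyC n (r ^+ 2) - normsq).
Proof.
move=> [s0 [s [r [hs0 hs E]]]].
have r1 : 0 <= r ^+ 2 + 1 by rewrite addr_ge0 ?sqr_ge0.
exists (Num.sqrt (r ^+ 2 + 1)); first by rewrite sqrtr_gt0 ltr_wpDl ?sqr_ge0.
exists (1 + s0), s; split=> //; first by apply: sospD => //; exact: sosp1.
by rewrite sqr_sqrtr // -addrA E addrA rmorphD rmorph1 [1 + _]addrC.
Qed.

Lemma comp_mpolyA k k' (p : mpoly n R) (us : n.-tuple (mpoly k R))
    (ts : k.-tuple (mpoly k' R)) :
  comp_mpoly ts (comp_mpoly us p) = comp_mpoly [tuple comp_mpoly ts (tnth us i) | i < n] p.
Proof.
rewrite [in RHS]comp_mpolyE [in LHS](comp_mpolyE p us) raddf_sum /=.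
apply: eq_bigr => al _; rewrite linearZ rmorph_prod /=; congr (_ *: _).
by apply: eq_bigr => i _; rewrite rmorphXn tnth_mktuple.
Qed.


Lemma psdmx1 : psdmx (1%:M : 'M[R]_m).
Proof.
split=> [|v]; first exact: trmx1.
by rewrite -/(qform _ _) qform_scalar_mx mul1r sqnorm_ge0.
Qed.

Hypotheses (esym : ssrbool.symmetric e) (eirr : irreflexive e) (che : chordal e).
Hypothesis hC : lists_maximal_cliques e C.

Lemma sparse_sos_box_pd (G : 'M[mpoly n R]_m) (r eps : R) :
  0 < r -> quadmod g (mpolyC n (r ^+ 2) - normsq) -> G^T = G -> sparse e G ->
  0 < eps -> (forall x, box n r x -> forall v, eps * sqnorm v <= qform (evalmx x G) v) ->
  sparse_sos g C G.
Proof.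
move=> r0 qr Gsym Gsp eps0 Gpos.
(* [us] carries the unit cube onto the box and [ts] is its inverse, so [H] is [G] in the coordinates
   of the cube. *)
pose us := [tuple (2 * r) *: mpolyX R (mnm1 i) - mpolyC n r | i < n].
pose ts := [tuple mpolyC n 2^-1 + (2 * r)^-1 *: mpolyX R (mnm1 i) | i < n].
pose H := map_mx (comp_mpoly us) G.
have HG i j : comp_mpoly ts (H i j) = G i j.
  rewrite mxE comp_mpolyA -[RHS]comp_mpoly_id; congr (comp_mpoly _ _).
  apply: eq_from_tnth => k; rewrite !tnth_mktuple raddfB /= linearZ /=.
  rewrite comp_mpolyXU -tnth_nth tnth_mktuple comp_mpolyC scalerDr scalerA.
  rewrite divff ?mulf_neq0 ?gt_eqF // scale1r addrAC -mul_mpolyC -mpolyCM.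
  by rewrite (_ : 2 * r * 2^-1 = r) ?subrr ?add0r //; field.
have Hsym i j : H i j = H j i by rewrite !mxE -{1}Gsym mxE.
have [K Kpos KH] : exists2 K : 'I_m -> 'I_m -> R, (forall i j, 0 <= K i j) &
    forall i j N (ka : {ffun 'I_n -> 'I_N.+1}), (msize (H i j) <= N)%N ->
    `|bern_coef ka (H i j) - meval (grid ka) (H i j)| <= K i j / N%:R.
  have h (ij : 'I_m * 'I_m) : exists K : R, 0 <= K /\
      forall N (ka : {ffun 'I_n -> 'I_N.+1}), (msize (H ij.1 ij.2) <= N)%N ->
      `|bern_coef ka (H ij.1 ij.2) - meval (grid ka) (H ij.1 ij.2)| <= K / N%:R.
    by have [K K0 hK] := bern_coef_dist (H ij.1 ij.2); exists K.
  have [K hK] := choice h.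
  exists (fun i j => K (i, j)) => [i j|i j N ka]; first exact: (hK (i, j)).1.
  exact: (hK (i, j)).2.
pose Ksum := \sum_i \sum_j K i j.
have K0 : 0 <= Ksum by apply: sumr_ge0 => i _; apply: sumr_ge0 => j _.
(* [N] is large enough to expand every entry and to keep the total coefficient error [Ksum / N]
   below the margin [eps]. *)
have [N HN NK] : exists2 N, forall i j, (msize (H i j) <= N)%N & Ksum <= eps * N%:R.
  exists (\max_i \max_j msize (H i j) + (Num.truncn (Ksum / eps)).+1)%N.
    move=> i j; apply: leq_trans (leq_addr _ _).
    by apply: leq_trans (leq_bigmax i); apply: (leq_bigmax j).
  rewrite mulrC -ler_pdivrMr //; apply: le_trans (ltW (truncnS_gt _)) _.
  by rewrite ler_nat leq_addl.
pose A (ka : {ffun 'I_n -> 'I_N.+1}) : 'M[R]_m := \matrix_(i, j) bern_coef ka (H i j).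
pose B (ka : {ffun 'I_n -> 'I_N.+1}) := \prod_(i < n) bernpoly N (ka i) (tnth ts i).
have -> : G = \sum_ka B ka *: map_mx (@mpolyC n R) (A ka).
  apply/matrixP => i j; rewrite -HG (comp_mpoly_bernstein _ (HN i j)) summxE.
  by apply: eq_bigr => ka _; rewrite !mxE mulrC mul_mpolyC.
apply: sparse_sos_sum => ka _; apply: (sparse_sos_psd esym eirr che hC).
- apply: (preorder1_sub_quadmod qr); apply: preorder1_prod => i _.
  have [t0 t1] := preorder1_box i r0.
  rewrite /bernpoly tnth_mktuple; apply: preorder1Z => //.
  by apply: preorder1M; exact: preorder1X.
- split=> [|v]; first by apply/matrixP => i j; rewrite mxE [LHS]mxE [RHS]mxE Hsym.
  (* The grid point moved to the box: [A ka] differs from [G] evaluated there by at most [Ksum / N]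
     as a quadratic form. *)
  pose x : 'rV[R]_n := \row_i (2 * r * grid ka i - r).
  have xbox : box n r x.
    move=> i; rewrite mxE.
    have /andP[g0 g1] : 0 <= (grid ka i : R) <= 1 by apply: ratio01; rewrite -ltnS.
    by apply/andP; split; nra.
  have xH i j : evalp x (G i j) = meval (grid ka) (H i j).
    rewrite mxE comp_mpoly_meval; apply: meval_eq => k.
    by rewrite tnth_mktuple mevalB mevalZ mevalXU mevalC mxE.
  have -> : A ka = evalmx x G + (A ka - evalmx x G) by rewrite addrC subrK.
  rewrite -/(qform _ _) qformD.
  have : `|qform (A ka - evalmx x G) v| <= (\sum_i \sum_j K i j / N%:R) * sqnorm v.
    rewrite [X in X * _](_ : _ = \sum_i \sum_j (\matrix_(i, j) (K i j / N%:R)) i j).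
      apply: qform_bound => i j; rewrite [leRHS]mxE.
      have -> : (A ka - evalmx x G) i j = bern_coef ka (H i j) - evalp x (G i j).
        by rewrite !mxE.
      by rewrite xH; exact: KH.
    by apply: eq_bigr => i _; apply: eq_bigr => j _; rewrite mxE.
  have -> : \sum_i \sum_j K i j / N%:R = Ksum / N%:R.
    by rewrite mulr_suml; apply: eq_bigr => i _; rewrite mulr_suml.
  have KN : Ksum / N%:R <= eps.
    have [->|N0] := posnP N; first by rewrite invr0 mulr0 ltW.
    by rewrite ler_pdivrMr ?ltr0n.
  have := ler_wpM2r (sqnorm_ge0 v) KN; have := Gpos x xbox v.
  rewrite ler_norml => h1 h2 /andP[h3 _]; lra.
- move=> i j ij nij; rewrite !mxE Gsp // comp_mpoly0 /bern_coef msupp0.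
  by rewrite big_nil.
Qed.

(** Write [F = (F - h I) + h I], with [h] making the first part positive definite on the box. A
    scalar shift keeps the pattern, and [h I] is certified term by term, since each [g j * s j] is
    in the quadratic module and the identity is sparse. *)
Lemma sparse_putinar (F : 'M[mpoly n R]_m) :
  archimedean_condition g -> F^T = F -> sparse e F ->
  (forall x, semialg g x -> pdmx (evalmx x F)) -> sparse_sos g C F.
Proof.
move=> /quadmod_ball[r r0 qr] Fsym Fsp Fpd.
have [s [eps [eps0 hs Fbox]]] := psd_on_box_of_pd_on_semialg r Fpd.
set h := \sum_(j < q) g j * s j in Fbox.
rewrite -(subrK h%:M F); apply: sparse_sosD.
  apply: (sparse_sos_box_pd r0 qr _ _ eps0 Fbox).
    by rewrite linearB /= tr_scalar_mx Fsym.
  move=> i j ij nij; rewrite !mxE Fsp // (negPf ij) mulr0n subr0 //.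
have -> : h%:M = h *: map_mx (@mpolyC n R) (1%:M : 'M[R]_m).
  by rewrite map_scalar_mx /= mpolyC1 scalemx1.
rewrite scaler_suml; apply: sparse_sos_sum => j _.
apply: (sparse_sos_psd esym eirr che hC) psdmx1 _; first exact: quadmod_gen.
by move=> i k ik _; rewrite mxE (negPf ik).
Qed.

End SparsePositivstellensatz.

(** * The relaxation *)

Section Relaxation.
Context {R : realType} {n m l q t : nat}.
Variables (P0 : 'M[mpoly n R]_m) (P : 'I_l -> 'M[mpoly n R]_m).
Variables (g : 'I_q -> mpoly n R) (C : 'I_t -> {set 'I_m}).
Hypotheses (hP0 : P0^T = P0) (hP : forall i, (P i)^T = P i).

Lemma pmx_sym lam : (pmx P0 P lam)^T = pmx P0 P lam.
Proof.
rewrite /pmx linearB /= hP0 raddf_sum /=; congr (_ - _).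
by apply: eq_bigr => i _; rewrite linearZ /= hP.
Qed.

Lemma sparsity_graph_sym : ssrbool.symmetric (sparsity_graph P0 P).
Proof.
move=> i j; rewrite /sparsity_graph eq_sym; congr (_ && ~~ _).
apply/asboolP/asboolP => h lam.
  by rewrite -pmx_sym mxE h.
by rewrite -pmx_sym mxE h.
Qed.

Lemma sparsity_graph_irr : irreflexive (sparsity_graph P0 P).
Proof. by move=> i; rewrite /sparsity_graph eqxx. Qed.

Lemma pmx_sparse lam : sparse (sparsity_graph P0 P) (pmx P0 P lam).
Proof.
by move=> i j ij; rewrite /sparsity_graph ij negbK => /asboolP.
Qed.

Lemma evalmx_pmx_combination x (c : R) lam lam' :
  evalmx x (pmx P0 P (c *: lam + (1 - c) *: lam')) =
    c *: evalmx x (pmx P0 P lam) + (1 - c) *: evalmx x (pmx P0 P lam').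
Proof.
have E lam1 i j : evalmx x (pmx P0 P lam1) i j =
    evalp x (P0 i j) - \sum_(k < l) lam1 ord0 k * evalp x (P k i j).
  rewrite !mxE /evalp mevalB summxE; congr (_ - _); rewrite raddf_sum /=.
  by apply: eq_bigr => k _; rewrite mxE mevalM mevalC.
apply/matrixP => i j; rewrite E mxE [X in _ = X + _]mxE [X in _ = _ + X]mxE !E.
move: (evalp x (P0 i j)) => p0.
rewrite !mulrBr !mulr_sumr addrACA -opprD -big_split /= -mulrDl.
have -> : c + (1 - c) = 1 by ring.
rewrite mul1r; congr (_ - _); apply: eq_bigr => k _; rewrite !mxE; ring.
Qed.

Lemma sos_feasible_mono d d' nu : (d <= d')%N ->
  sos_feasible P0 P g C d nu `<=` sos_feasible P0 P g C d' nu.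
Proof.
move=> dd' lam [S0 [S [E hS0 hS]]]; exists S0, S; split=> [//|k|j k].
  by have [h1 h2] := hS0 k; split=> //; lia.
by have [h1 h2] := hS j k; split=> //; lia.
Qed.

Lemma sparse_sos_feasible lam : sparse_sos g C (pmx P0 P lam) ->
  exists d, sos_feasible P0 P g C d 0 lam.
Proof.
move=> [S0 [S [E hS0 hS]]].
(* The summand [uphalf (degp (g j))] makes up for the subtraction in the degree bound of [S j k]. *)
exists (\max_k degmx (S0 k) + \max_j \max_k (degmx (S j k) + uphalf (degp (g j))))%N.
exists S0, S; split=> [|k|j k]; first by rewrite expr0 scale1r.
  split=> //; have := leq_bigmax (F := fun k => degmx (S0 k)) k; lia.
split=> //.
have := leq_bigmax (F := fun k => (degmx (S j k) + uphalf (degp (g j)))%N) k.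
have := leq_bigmax
  (F := fun j => (\max_k (degmx (S j k) + uphalf (degp (g j))))%N) j.
lia.
Qed.

Lemma sosmx_qform_ge0 k (A : 'M[mpoly n R]_k) x v :
  sosmx A -> 0 <= qform (evalmx x A) v.
Proof.
move=> [s [H ->]]; rewrite /evalmx /evalp map_mxM -map_trmx.
set M := map_mx _ H; have -> : qform (M^T *m M) v = sqnorm (M *m v).
  by rewrite -[RHS]mul1r -qform_scalar_mx /qform mulmx1 trmx_mul !mulmxA.
exact: sqnorm_ge0.
Qed.

(** Evaluated at a point of the semialgebraic set, the certificate is a sum of congruences of
    positive semidefinite matrices with weights [g_j(x) >= 0]. *)
Lemma sos_feasible_sound d lam :
  sos_feasible P0 P g C d 0 lam -> pmi_feasible P0 P (semialg g) lam.
Proof.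
move=> [S0 [S [E hS0 hS]]] x xK; split.
  by rewrite /evalmx -[in LHS]pmx_sym map_trmx trmxK.
move=> v; rewrite -/(qform _ _).
move: E; rewrite expr0 scale1r => ->.
rewrite /evalmx /evalp raddf_sum /=.
apply: qform_sum_ge0 => k; rewrite !map_mxM -map_trmx.
set M := map_mx _ (cliquemx _); set A := map_mx _ (_ + _).
have -> : qform (M^T *m A *m M) v = qform A (M *m v).
  by rewrite /qform trmx_mul !mulmxA.
rewrite /A map_mxD qformD addr_ge0 //; first exact: sosmx_qform_ge0 (hS0 k).1.
rewrite raddf_sum; apply: qform_sum_ge0 => j /=.
rewrite map_mxZ qformZ mulr_ge0 //; first exact: xK.
exact: sosmx_qform_ge0 (hS j k).1.
Qed.

End Relaxation.

(** * Convergence of the relaxation values from above *)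

Theorem theorem3p1 (R : realType) (n m l q t : nat)
  (b : 'rV[R]_l -> R)
  (P0 : 'M[mpoly n R]_m) (P : 'I_l -> 'M[mpoly n R]_m)
  (g : 'I_q -> mpoly n R) (C : 'I_t -> {set 'I_m})
  (hb : convex_function [set: 'rV[R]_l] b)
  (hP0 : P0^T = P0) (hP : forall i, (P i)^T = P i)
  (hchordal : chordal (sparsity_graph P0 P))
  (hC : lists_maximal_cliques (sparsity_graph P0 P) C)
  (hK : compact (semialg g))
  (harch : archimedean_condition g)
  (hstrict : exists lam0 : 'rV[R]_l,
     forall x, semialg g x -> pdmx (evalmx x (pmx P0 P lam0))) :
  (forall d : nat, admissible P0 P g d 0 ->
     (pmi_value P0 P b (semialg g) <= sos_value P0 P g C b d 0)%E) /\
  sos_value P0 P g C b d 0 @[d --> \oo] --> pmi_value P0 P b (semialg g).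
Proof.
have sound d : (pmi_value P0 P b (semialg g) <= sos_value P0 P g C b d 0)%E.
  apply: ereal_inf_le_tmp => _ [lam hlam <-]; exists lam => //.
  exact: sos_feasible_sound hlam.
split=> [d _ //|].
have mono : {homo (fun d => sos_value P0 P g C b d 0) :
    d d' / (d <= d')%N >-> (d' <= d)%E}.
  move=> d d' dd'; apply: ereal_inf_le_tmp => _ [lam hlam <-]; exists lam => //.
  exact: sos_feasible_mono hlam.
(* A nonincreasing sequence converges to its infimum, which remains to be identified with the
   optimal value. *)
have := ereal_nonincreasing_cvgn mono.
suff -> : ereal_inf (range (fun d => sos_value P0 P g C b d 0)) =
    pmi_value P0 P b (semialg g) by [].
apply/eqP; rewrite eq_le; apply/andP; split; last first.
  by apply: le_ereal_inf_tmp => _ [d _ <-]; exact: sound.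
apply: le_ereal_inf_tmp => _ [lam hlam <-].
have [lam0 hlam0] := hstrict.
apply/lee_addgt0Pr => eps eps0.
pose D := `|b lam0 - b lam|.
(* Chosen so that [0 < s <= 1] and [s * D <= eps]: by convexity, moving from [lam] to [mu] raises
   [b] by at most [eps]. *)
pose s := eps / (eps + D).
have D0 : 0 <= D := normr_ge0 _.
have eD0 : 0 < eps + D by rewrite ltr_wpDr.
have s0 : 0 < s by rewrite divr_gt0.
have s1 : s <= 1 by rewrite ler_pdivrMr // mul1r lerDl.
pose mu := s *: lam0 + (1 - s) *: lam.
have bmu : b mu <= b lam + eps.
  have := hb (Itv01 (ltW s0) s1) lam0 lam; rewrite !in_setT => /(_ isT isT).
  rewrite convRE /= => /le_trans; apply.
  have sD : s * D <= eps.
    by rewrite /s mulrAC ler_pdivrMr // ler_pM2l // lerDr ltW.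
  have aux (u w c d a : R) : c * (u - w) <= c * d -> c * d <= a ->
      c * u + (1 - c) * w <= w + a by lra.
  exact: aux (ler_wpM2l (ltW s0) (ler_norm _)) sD.
(* The matrix is affine in the parameter, so a positive share of [lam0] makes it strictly positive
   definite at [mu]. *)
have mupd x : semialg g x -> pdmx (evalmx x (pmx P0 P mu)).
  move=> xK; rewrite evalmx_pmx_combination.
  exact: pdmx_conv (hlam0 x xK) (hlam x xK).
have [d hd] := sparse_sos_feasible (sparse_putinar (sparsity_graph_sym hP0 hP)
  (sparsity_graph_irr P0 P) hchordal hC harch (pmx_sym hP0 hP mu) (pmx_sparse mu) mupd).
apply: (@le_trans _ _ (b mu)%:E); last by rewrite -EFinD lee_fin.
apply: (@le_trans _ _ (sos_value P0 P g C b d 0)).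
  by apply: ereal_inf_lbound; exists d.
by apply: ereal_inf_lbound; exists mu.
Qed.
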